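(* There exists a polynomial-time algorithm which, given a lattice polygon $P \subset \mathbb{R}^2$ (by the list of its vertices), computes, for every direction in which a lattice diameter line of $P$ exists, a lattice diameter line of $P$ in that direction. In particular, the lattice diameter of $P$ can be computed in polynomial time.
   Context: A lattice polygon is a two-dimensional convex polytope in $\mathbb{R}^2$ all of whose vertices lie in $\mathbb{Z}^2$. The input is the list of integer coordinates of the vertices in binary encoding; polynomial time means polynomial in $n$ and $\log_2(c)$, where $n$ is the number of vertices of $P$ and $c$ is the largest absolute value of a coordinate of a vertex. For a compact set $S \subset \mathbb{R}^d$ with $S\cap\mathbb{Z}^d \neq \emptyset$, the lattice diameter of $S$ is $\operatorname{diam}_{\mathbb{Z}}(S) := \max_{x,y \in S \cap \mathbb{Z}^d} |\operatorname{conv}(\{x,y\}) \cap \mathbb{Z}^d| - 1$. If $x, y$ attain this maximum, then $\operatorname{conv}(\{x,y\})$ is a lattice diameter segment of $S$, and $\operatorname{aff}(\{x,y\})$ is a lattice diameter line of $S$, and its direction is $y-x$ up to non-zero multiples. *)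

(* Defs.v *)
From mathcomp Require Import all_boot all_order all_algebra finmap.
From mathcomp Require Import boolp classical_sets cardinality reals.

Set Implicit Arguments.
Unset Strict Implicit.
Unset Printing Implicit Defensive.

Import Order.TTheory GRing.Theory Num.Theory.

Local Open Scope classical_set_scope.
Local Open Scope ring_scope.

Section Geometry.
Variables (R : realType) (d : nat).
Implicit Types (S P L : set 'rV[R]_d) (x y u v : 'rV[R]_d).

Definition conv S : set 'rV[R]_d :=
  [set v | exists (n : nat) (a : 'I_n -> R) (p : 'I_n -> 'rV[R]_d),
     [/\ forall i, 0 <= a i, \sum_i a i = 1, forall i, S (p i)
       & v = \sum_i a i *: p i]].

Definition aff S : set 'rV[R]_d :=
  [set v | exists (n : nat) (a : 'I_n -> R) (p : 'I_n -> 'rV[R]_d),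
     [/\ \sum_i a i = 1, forall i, S (p i) & v = \sum_i a i *: p i]].

Definition polytope P := exists s : seq 'rV[R]_d, P = conv [set` s].

(* Vertices are taken to be the extreme points. *)
Definition vertex P v :=
  P v /\ forall x y (t : R), P x -> P y -> 0 < t < 1 ->
           v = t *: x + (1 - t) *: y -> x = v /\ y = v.

Definition lattice : set 'rV[R]_d :=
  [set x | forall i, x ord0 i \is a Num.int].

(* A segment contains finitely many lattice points, so [fset_set], which sends
   infinite sets to the empty set, does not lose any of them. *)
Definition seg_points x y : nat :=
  #|` fset_set (conv [set x; y] `&` lattice) |.

Definition diameter_pair S x y :=
  [/\ (S `&` lattice) x, (S `&` lattice) y
    & forall x' y', (S `&` lattice) x' -> (S `&` lattice) y' ->
        (seg_points x' y' <= seg_points x y)%N].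

(* The truncated predecessor is harmless: [x] itself is one of the counted
   points. *)
Definition is_lattice_diameter S (k : nat) :=
  exists x y, diameter_pair S x y /\ k = (seg_points x y).-1.

Definition lattice_diameter_line S L :=
  exists x y, diameter_pair S x y /\ L = aff [set x; y].

Definition has_direction L u :=
  exists x y (a : R), [/\ x != y, L = aff [set x; y], a != 0
                        & u = a *: (y - x)].

End Geometry.

Definition lattice_polygon (R : realType) (P : set 'rV[R]_2) :=
  [/\ polytope P, aff P = setT & forall v, vertex P v -> lattice v].

Definition point (R : realType) (v : int * int) : 'rV[R]_2 :=
  \row_(j < 2) (if j == ord0 then v.1 else v.2)%:~R.

(* The vertices are listed without repetition, in an arbitrary order. *)
Definition vertex_list (R : realType) (P : set 'rV[R]_2)
    (vs : seq (int * int)) :=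
  uniq vs /\ forall v, vertex P v <-> exists2 z, z \in vs & v = point R z.

Definition max_coord (vs : seq (int * int)) : nat :=
  \max_(v <- vs) maxn `|v.1|%N `|v.2|%N.

(* Algorithms are programs of a random access machine with structured control
   flow and logarithmic cost. The memory is indexed by all integers; a register
   is an expression [Read] of a constant address. *)

Inductive binop := Add | Sub | Mul | Div | Lt.

Inductive expr :=
| Const of int
| Read of expr
| Op of binop & expr & expr.

Inductive cmd :=
| Skip
| Write of expr & expr    (* address, value *)
| Seq of cmd & cmd
| If of expr & cmd & cmd
| While of expr & cmd.

Definition memory := int -> int.

Definition upd (m : memory) (a z : int) : memory :=
  fun b => if b == a then z else m b.

Definition eval_op (o : binop) (a b : int) : int :=
  match o with
  | Add => a + b
  | Sub => a - b
  | Mul => a * b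
  | Div => (a %/ b)%Z
  | Lt => (nat_of_bool (a < b))%:Z
  end.

Fixpoint eval (m : memory) (e : expr) : int :=
  match e with
  | Const z => z
  | Read e => m (eval m e)
  | Op o e1 e2 => eval_op o (eval m e1) (eval m e2)
  end.

(* The number of binary digits of |z|, with value 1 at 0. *)
Definition bitlen (z : int) : nat := (trunc_log 2 `|z|).+1.

(* Every operation is charged the schoolbook bit cost of a product, and every
   memory access the length of the address and of the contents. *)
Fixpoint ecost (m : memory) (e : expr) : nat :=
  match e with
  | Const z => bitlen z
  | Read e => (ecost m e + bitlen (eval m e) + bitlen (m (eval m e)))%N
  | Op _ e1 e2 =>
      (ecost m e1 + ecost m e2 + bitlen (eval m e1) * bitlen (eval m e2))%N
  end.

(* [exec c m t m']: started in memory [m], [c] halts at cost [t] in [m']. *)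
Inductive exec : cmd -> memory -> nat -> memory -> Prop :=
| ExecSkip m : exec Skip m 1 m
| ExecWrite m a e :
    exec (Write a e) m
      (ecost m a + ecost m e + bitlen (eval m a) + bitlen (eval m e))
      (upd m (eval m a) (eval m e))
| ExecSeq c1 c2 m1 m2 m3 t1 t2 :
    exec c1 m1 t1 m2 -> exec c2 m2 t2 m3 -> exec (Seq c1 c2) m1 (t1 + t2) m3
| ExecIfTrue e c1 c2 m m' t :
    eval m e != 0 -> exec c1 m t m' ->
    exec (If e c1 c2) m (ecost m e + t) m'
| ExecIfFalse e c1 c2 m m' t :
    eval m e = 0 -> exec c2 m t m' ->
    exec (If e c1 c2) m (ecost m e + t) m'
| ExecWhileTrue e c m1 m2 m3 t1 t2 :
    eval m1 e != 0 -> exec c m1 t1 m2 -> exec (While e c) m2 t2 m3 ->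
    exec (While e c) m1 (ecost m1 e + t1 + t2) m3
| ExecWhileFalse e c m :
    eval m e = 0 -> exec (While e c) m (ecost m e) m.

(* Lists of integers are passed through the addresses 0, 1, 2, ..., preceded by
   their length; at the start all other addresses contain 0. *)
Definition input_memory (s : seq int) : memory := fun a =>
  match a with
  | Posz 0 => (size s)%:Z
  | Posz i.+1 => s`_i
  | Negz _ => 0
  end.

Definition holds_output (m : memory) (s : seq int) :=
  m 0 = (size s)%:Z /\ forall i : nat, (i < size s)%N -> m i.+1%:Z = s`_i.

Definition encode_points (vs : seq (int * int)) : seq int :=
  flatten [seq [:: v.1; v.2] | v <- vs].

Definition polygon_problem_in_polytime (R : realType)
    (post : set 'rV[R]_2 -> seq int -> Prop) :=
  exists (prog : cmd) (C k : nat),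
    forall (P : set 'rV[R]_2) (vs : seq (int * int)),
      lattice_polygon P -> vertex_list P vs ->
      exists (t : nat) (m : memory) (out : seq int),
        [/\ exec prog (input_memory (encode_points vs)) t m,
            (t <= C * (size vs + trunc_log 2 (max_coord vs)) ^ k)%N,
            holds_output m out
          & post P out].

(* A line is encoded by a pair of distinct lattice points on it. *)
Definition line_of (R : realType) (l : (int * int) * (int * int)) :
    set 'rV[R]_2 :=
  aff [set point R l.1; point R l.2].

Definition encode_lines (ls : seq ((int * int) * (int * int))) : seq int :=
  flatten [seq [:: l.1.1; l.1.2; l.2.1; l.2.2] | l <- ls].

Definition diameter_lines_of (R : realType) (P : set 'rV[R]_2)
    (ls : seq ((int * int) * (int * int))) :=
  [/\ uniq ls,
      forall l, l \in ls -> l.1 != l.2 /\ lattice_diameter_line P (@line_of R l)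
    & forall u : 'rV[R]_2,
        (exists L, lattice_diameter_line P L /\ has_direction L u) ->
        exists! l, l \in ls /\ has_direction (@line_of R l) u].

Definition outputs_diameter_lines (R : realType) (P : set 'rV[R]_2)
    (out : seq int) :=
  exists2 ls, out = encode_lines ls & diameter_lines_of P ls.

Definition outputs_lattice_diameter (R : realType) (P : set 'rV[R]_2)
    (out : seq int) :=
  exists2 k : nat, out = [:: k%:Z] & is_lattice_diameter P k.

(* Main.v *)
Require Import Defs.
From mathcomp Require Import all_boot all_order all_algebra reals.
From mathcomp Require Import finmap boolp classical_sets cardinality.
From mathcomp Require Import zify ring lra.
Import Defs.

(* Write [A = a - v], [B = b - v] for a triple of vertices.  A longest chord of
   [P] in a given direction may be slid until one of its ends is a vertex [v] and
   the other lies on a segment [[a, b]] between vertices; a lattice direction [u]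
   therefore contributes the largest [reach u v a b], the number of steps [u] or
   [- u] that fit into the triangle [v a b] from [v].  When [v a b] is a triangle
   of maximal area, the quadratic form [det(z, B)^2 + det(A, z)^2] is within a
   constant factor of the square of the norm with unit ball [P - P], so that in a
   basis of the lattice reduced for this form (Gauss) every diameter direction
   has coefficients of absolute value at most 15.  The program tries all those
   directions with all triples of vertices. *)

Set Implicit Arguments.
Unset Strict Implicit.
Unset Printing Implicit Defensive.

Import Order.TTheory GRing.Theory Num.Theory.

(** * Cost of random access machine programs *)

(** Coordinates may be exponential in the input size, so neither lattice points nor directions can
    be listed naively. A constant number of directions suffices by a comparison of norms: if [u] has
    the maximal reach [k], then [k * u] is short against the triangle of maximal area, while the
    basis vector [b1], whose reach from the corners of that triangle is at most [k], cannot be much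
    shorter than [u]. This gives [qform u < 64 * qform b1], which a reduced basis turns into a bound
    on coefficients. Sliding yields a real chord, but nothing is lost: it starts at a lattice
    vertex, so whole steps of [u] end at lattice points and rounding down is exact. A direction
    attaining the maximum is automatically primitive, so that diameter directions correspond to
    candidate vectors up to sign. For the running time, a single [L] bounds the length of every
    stored integer. Only the Gauss loop needs an argument for its number of rounds: it continues
    only while the norm is halved, and the resulting basis is reduced up to a factor 2. *)

Lemma bitlen_le (z : int) (L : nat) : (0 < L)%N -> (`|z| < 2 ^ L)%N -> (bitlen z <= L)%N.
Proof.
rewrite /bitlen => L0 h; case: (posnP `|z|%N) => [->|z0]; first by rewrite trunc_log0.
by rewrite -(ltn_exp2l _ _ (isT : 1 < 2)%N); apply: leq_ltn_trans h; apply: trunc_logP.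
Qed.

Lemma ltn_bitlen (z : int) : (`|z| < 2 ^ bitlen z)%N.
Proof. exact: trunc_log_ltn. Qed.

(** Only a product needs the sum of the lengths; the other operations fit because every length is at
    least 1, so that both powers of two are at least 2. *)
Lemma bitlen_op o a b : (bitlen (eval_op o a b) <= bitlen a + bitlen b)%N.
Proof.
apply: bitlen_le; first by rewrite addn_gt0.
have ha := ltn_bitlen a; have hb := ltn_bitlen b.
have pa : (2 <= 2 ^ bitlen a)%N by rewrite -[X in (X <= _)%N]expn1 leq_exp2l.
have pb : (2 <= 2 ^ bitlen b)%N by rewrite -[X in (X <= _)%N]expn1 leq_exp2l.
rewrite expnD; move: (2 ^ bitlen a)%N (2 ^ bitlen b)%N ha hb pa pb => x y ha hb pa pb.
case: o => /=.
- have : (`|(a + b)%R| <= `|a| + `|b|)%N by lia.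
  nia.
- have : (`|(a - b)%R| <= `|a| + `|b|)%N by lia.
  nia.
- by rewrite abszM; nia.
- have h : (`|(a %/ b)%Z| <= `|a|)%N.
    (* Division by zero returns 0, so the estimate holds for every divisor. *)
    have := divz_eq a b; case: (eqVneq b 0%R) => [->|b0]; first by rewrite divz0.
    have := modz_ge0 a b0; have := ltz_mod a b0.
    move: (a %/ b)%Z (a %% b)%Z => q r; nia.
  nia.
- by case: (_ < _)%R => /=; nia.
Qed.

Definition bnd (L : nat) (m : memory) := forall a, (bitlen (m a) <= L)%N.

(** When every cell has at most [L] bits, [esize e * L] bounds the length of the value of [e]. A
    [Read] counts 1 because it returns the content of a cell, however long the address. *)
Fixpoint esize (e : expr) : nat :=
  match e with
  | Const z => bitlen z
  | Read e => 1
  | Op _ e1 e2 => esize e1 + esize e2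
  end.

(** Cost of an evaluation in units of [L ^ 2]; the linear charges are absorbed by [L <= L ^ 2]. *)
Fixpoint ework (e : expr) : nat :=
  match e with
  | Const z => bitlen z
  | Read e => ework e + esize e + 1
  | Op _ e1 e2 => ework e1 + ework e2 + esize e1 * esize e2
  end.

Section Bound.
Variable L : nat.
Hypothesis L_gt0 : (0 < L)%N.

Lemma bitlen_eval m e : bnd L m -> (bitlen (eval m e) <= esize e * L)%N.
Proof.
move=> hm; elim: e => [z|e IH|o e1 IH1 e2 IH2] /=.
- by rewrite leq_pmulr.
- by rewrite mul1n.
- by apply: leq_trans (bitlen_op _ _ _) _; rewrite mulnDl leq_add.
Qed.

Lemma ecost_le m e : bnd L m -> (ecost m e <= ework e * L ^ 2)%N.
Proof.
move=> hm; elim: e => [z|e IH|o e1 IH1 e2 IH2] /=.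
- by rewrite leq_pmulr // expn_gt0 L_gt0.
- have h1 := bitlen_eval e hm; have h2 := hm (eval m e).
  have h3 : (L <= L ^ 2)%N by nia.
  nia.
- have h1 := bitlen_eval e1 hm; have h2 := bitlen_eval e2 hm.
  have := leq_mul h1 h2; rewrite !mulnDl mulnACA mulnn; lia.
Qed.

(** Cost in units of [L ^ 2], both branches of a test being charged. The value at [While] is a
    placeholder, since [wp] excludes loops. *)
Fixpoint cwork (c : cmd) : nat :=
  match c with
  | Skip => 1
  | Write a e => ework a + ework e + esize a + esize e
  | Seq c1 c2 => cwork c1 + cwork c2
  | If e c1 c2 => ework e + cwork c1 + cwork c2
  | While e c => 0
  end.

(* [False] on loops, which are handled by [runs_while] instead. *)
Fixpoint wp (c : cmd) (Q : memory -> Prop) (m : memory) : Prop :=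
  match c with
  | Skip => Q m
  | Write a e =>
      (bitlen (eval m e) <= L)%N /\ Q (upd m (eval m a) (eval m e))
  | Seq c1 c2 => wp c1 (wp c2 Q) m
  | If e c1 c2 =>
      (eval m e != 0%R -> wp c1 Q m) /\ (eval m e = 0%R -> wp c2 Q m)
  | While _ _ => False
  end.

Lemma wp_mono c (Q Q' : memory -> Prop) m :
  (forall m', Q m' -> Q' m') -> wp c Q m -> wp c Q' m.
Proof.
elim: c Q Q' m => [|a e|c1 IH1 c2 IH2|e c1 IH1 c2 IH2|//] Q Q' m h /=.
- exact: h.
- by move=> [he /h].
- by apply: IH1 => m'; apply: IH2.
- by move=> [h1 h2]; split=> [/h1|/h2]; [apply: IH1|apply: IH2].
Qed.

(** Total correctness with a time bound in units of [L ^ 2]. The conclusion contains [bnd L] so that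
    the next command can again be charged in this unit. *)
Definition runs (c : cmd) (T : nat) (m : memory) (Q : memory -> Prop) :=
  exists t m', [/\ exec c m t m', (t <= T * L ^ 2)%N, bnd L m' & Q m'].

Lemma bnd_upd m a z : bnd L m -> (bitlen z <= L)%N -> bnd L (upd m a z).
Proof. by move=> hm hz b; rewrite /upd; case: eqP. Qed.

Lemma wp_runs c Q m : bnd L m -> wp c Q m -> runs c (cwork c) m Q.
Proof.
elim: c Q m => [|a e|c1 IH1 c2 IH2|e c1 IH1 c2 IH2|//] Q m hm /=.
- by move=> hQ; exists 1%N, m; split; [constructor|rewrite mul1n expn_gt0 L_gt0| |].
- move=> [he hQ]; exists (ecost m a + ecost m e + bitlen (eval m a) + bitlen (eval m e))%N, (upd m (eval m a) (eval m e)).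
  split; [by constructor| |exact: bnd_upd|exact: hQ].
  have h1 := ecost_le a hm; have h2 := ecost_le e hm.
  have h3 := bitlen_eval a hm; have h4 := bitlen_eval e hm.
  have h5 : (L <= L ^ 2)%N by nia.
  nia.
- move=> /(IH1 _ _ hm)[t1 [m1 [x1 l1 b1 /(IH2 _ _ b1)[t2 [m2 [x2 l2 b2 q2]]]]]].
  exists (t1 + t2)%N, m2; split=> //; first by econstructor; eassumption.
  by rewrite mulnDl leq_add.
- move=> [hT hF]; have hc := ecost_le e hm.
  have [e0|e0] := eqVneq (eval m e) 0%R.
    have [t [m' [x l b q]]] := IH2 _ _ hm (hF e0).
    exists (ecost m e + t)%N, m'; split=> //; first exact: ExecIfFalse.
    by rewrite !mulnDl; lia.
  have [t [m' [x l b q]]] := IH1 _ _ hm (hT e0).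
  exists (ecost m e + t)%N, m'; split=> //; first exact: ExecIfTrue.
  by rewrite !mulnDl; lia.
Qed.

Lemma runs_leq c T T' m Q : (T <= T')%N -> runs c T m Q -> runs c T' m Q.
Proof.
move=> h [t [m' [x l b q]]]; exists t, m'; split=> //.
by apply: leq_trans l _; rewrite leq_mul2r h orbT.
Qed.

Lemma runs_seq c1 c2 T1 T2 m Q1 Q2 :
  runs c1 T1 m Q1 -> (forall m', bnd L m' -> Q1 m' -> runs c2 T2 m' Q2) ->
  runs (Seq c1 c2) (T1 + T2) m Q2.
Proof.
move=> [t1 [m1 [x1 l1 b1 q1]]] /(_ m1 b1 q1) [t2 [m2 [x2 l2 b2 q2]]].
exists (t1 + t2)%N, m2; split=> //; first by econstructor; eassumption.
by rewrite mulnDl leq_add.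
Qed.

(** The index of the invariant is fuel: a nonzero guard forces it to be a successor and the body
    lowers it by one, so the guard is evaluated at most [N + 1] times. *)
Lemma runs_while (I : nat -> memory -> Prop) e c N m :
  (forall k m', bnd L m' -> I k m' -> eval m' e != 0%R ->
     exists2 k', k = k'.+1 & wp c (I k') m') ->
  bnd L m -> I N m ->
  runs (While e c) (N.+1 * (ework e + cwork c)) m
    (fun m' => (exists k, I k m') /\ eval m' e = 0%R).
Proof.
move=> step; elim: N m => [|N IH] m hm hI; have hc := ecost_le e hm;
  have [e0|e0] := eqVneq (eval m e) 0%R.
- exists (ecost m e), m; split=> //; [exact: ExecWhileFalse|nia|].
  by split=> //; exists 0%N.
- by have [k'] := step _ _ hm hI e0.
- exists (ecost m e), m; split=> //; [exact: ExecWhileFalse|nia|].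
  by split=> //; exists N.+1.
have [k' [<-] /(wp_runs hm)[t1 [m1 [x1 l1 b1 /(IH _ b1)[t2 [m2 [x2 l2 b2 q2]]]]]]] := step _ _ hm hI e0.
exists (ecost m e + t1 + t2)%N, m2; split=> //; first exact: ExecWhileTrue x2.
rewrite [N.+2]lock mulSn -lock in l2 *; nia.
Qed.

Lemma runs_for (I : nat -> memory -> Prop) e c N m :
  (forall i m', bnd L m' -> I i m' ->
     (i <= N)%N /\ eval m' e = nat_of_bool (i < N)%N) ->
  (forall i m', bnd L m' -> I i m' -> (i < N)%N -> wp c (I i.+1) m') ->
  bnd L m -> I 0%N m -> runs (While e c) (N.+1 * (ework e + cwork c)) m (I N).
Proof.
(* The upward count [i] becomes the remaining fuel [k = N - i]. *)
move=> guard step hm h0; pose J k m' := exists2 i, (i + k)%N = N & I i m'.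
have [||t [m' [x l b [[k [i ik hI]] e0]]]] := @runs_while J e c N m _ hm.
- move=> k m' hm' [i ik hI]; have [hi ->] := guard _ _ hm' hI.
  case: ltnP => // hiN _; case: k ik => [|k] ik; first by move: hiN; rewrite -ik addn0 ltnn.
  exists k => //; apply: (wp_mono _ (step _ _ hm' hI hiN)) => m'' h.
  by exists i.+1 => //; rewrite addSnnS.
- by exists 0%N.
exists t, m'; split=> //; have [hi] := guard _ _ b hI.
by rewrite e0; case: ltnP => // hN _; rewrite (_ : N = i) //; apply/eqP; rewrite eqn_leq hN.
Qed.

End Bound.

(** * Lattice reduction *)

Local Open Scope ring_scope.

Notation pt := (int * int)%type.

Definition det2 (a b : pt) : int := a.1 * b.2 - a.2 * b.1.

Lemma det2_cramer (A B u : pt) :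
  det2 A B * u.1 = det2 u B * A.1 + det2 A u * B.1 /\
  det2 A B * u.2 = det2 u B * A.2 + det2 A u * B.2.
Proof. by rewrite /det2; split; ring. Qed.

Lemma det2_eq0 (A B u : pt) :
  det2 A B != 0 -> det2 u B = 0 -> det2 A u = 0 -> u = 0.
Proof.
move=> D0 z1 z2; have [] := det2_cramer A B u.
rewrite z1 z2 !mul0r addr0 => /eqP; rewrite mulf_eq0 (negPf D0) => /eqP e1.
move/eqP; rewrite mulf_eq0 (negPf D0) => /eqP e2.
by case: u e1 e2 {z1 z2} => x y /= -> ->.
Qed.

Definition area (v a b : pt) : int := det2 (a - v) (b - v).

(** By Cramer's rule the two determinants, divided by the area, are the coordinates of [u] in the
    basis [a - v], [b - v]. A multiple [k * u] or [- k * u] stays in the triangle exactly when they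
    do not have opposite signs and [k] times the absolute value of their sum is at most 1. Division
    by zero gives the value 0 in the degenerate cases. *)
Definition reach (u v a b : pt) : nat :=
  if det2 u (b - v) * det2 (a - v) u < 0 then 0%N
  else (`|area v a b| %/ `|(det2 u (b - v) + det2 (a - v) u)%R|)%N.

Lemma reach_bound u v a b :
  (reach u v a b * `|(det2 u (b - v) + det2 (a - v) u)%R| <= `|area v a b|)%N.
Proof. by rewrite /reach; case: ifP => _ //; apply: leq_divM. Qed.

Lemma reachN u v a b : reach (- u) v a b = reach u v a b.
Proof.
rewrite /reach.
have -> : det2 (- u) (b - v) = - det2 u (b - v) by rewrite /det2 /=; ring.
have -> : det2 (a - v) (- u) = - det2 (a - v) u by rewrite /det2 /=; ring.
by rewrite mulrNN -opprD abszN.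
Qed.

Lemma reach_gt0 u v a b : (0 < reach u v a b)%N ->
  [/\ area v a b != 0, 0 <= det2 u (b - v) * det2 (a - v) u
    & det2 u (b - v) + det2 (a - v) u != 0].
Proof.
rewrite /reach; case: ltrP => // ? h; split=> //.
  by apply: contraTneq h => ->; rewrite absz0 div0n.
by apply: contraTneq h => ->; rewrite absz0 divn0.
Qed.

Lemma reach_ge k u v a b : area v a b != 0 -> u != 0 ->
  0 <= det2 u (b - v) * det2 (a - v) u ->
  (k * `|(det2 u (b - v) + det2 (a - v) u)%R| <= `|area v a b|)%N ->
  (k <= reach u v a b)%N.
Proof.
move=> A0 u0 h hk; rewrite /reach ltNge h /= leq_divRL //.
rewrite absz_gt0; apply: contra_neq u0 => s0.
have z1 : det2 u (b - v) = 0 by nia.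
have z2 : det2 (a - v) u = 0 by nia.
exact: det2_eq0 z1 z2.
Qed.

Lemma absz_addle (x y : int) : (`|(x + y)%R| <= `|x| + `|y|)%N.
Proof. lia. Qed.

Lemma norm_lt_of_sqr (z w : int) : 0 <= w -> z ^+ 2 < w ^+ 2 -> `|z| < w.
Proof.
by move=> w0; rewrite -(real_normK (num_real z)) ltr_pXn2r ?nnegrE.
Qed.

Section Reduced.
Variables (A B : pt).

Definition qdot (u w : pt) : int :=
  det2 u B * det2 w B + det2 A u * det2 A w.
Definition qform (u : pt) : int := qdot u u.

Lemma qform_ge0 u : 0 <= qform u.
Proof. by rewrite /qform /qdot; nia. Qed.

Lemma qform_gt0 u : det2 A B != 0 -> u != 0 -> 0 < qform u.
Proof.
move=> D0 u0; rewrite lt_def qform_ge0 andbT; apply: contra_neq u0 => q0.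
have z1 : det2 u B = 0 by move: q0; rewrite /qform /qdot; nia.
have z2 : det2 A u = 0 by move: q0; rewrite /qform /qdot; nia.
exact: det2_eq0 z1 z2.
Qed.

Definition lin (x y : int) (b1 b2 : pt) : pt :=
  (x * b1.1 + y * b2.1, x * b1.2 + y * b2.2).

Lemma qform_lin x y b1 b2 :
  qform (lin x y b1 b2) =
  x ^+ 2 * qform b1 + 2 * x * y * qdot b1 b2 + y ^+ 2 * qform b2.
Proof. by rewrite /qform /qdot /det2 /lin /=; ring. Qed.

(** With [p], [r], [s] for the two norms and the product, completing the square writes [4 p] times
    the norm as [(2xp + 2ys)^2 + y^2 (4pr - 4s^2)]. The reduction hypotheses give
    [4pr - 4s^2 >= 2p^2 - p^2 = p^2], so both [|y| p] and [|2xp + 2ys|] are below [16 p], where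
    [16^2 = 4 * 64]. Then [|y| <= 15] and [|2ys| <= 15 p] bound [x]. *)
Lemma reduced_coef b1 b2 x y :
  0 < qform b1 -> 2 * `|qdot b1 b2| <= qform b1 -> qform b1 <= 2 * qform b2 ->
  qform (lin x y b1 b2) < 64 * qform b1 -> `|x| <= 15 /\ `|y| <= 15.
Proof.
rewrite qform_lin; move: (qform b1) (qform b2) (qdot b1 b2) => p r s p0 hs hr h.
have h1 : (2 * x * p + 2 * y * s) ^+ 2 + y ^+ 2 * (4 * p * r - 4 * s ^+ 2) < 256 * p ^+ 2.
  have -> : (2 * x * p + 2 * y * s) ^+ 2 + y ^+ 2 * (4 * p * r - 4 * s ^+ 2)
    = 4 * p * (x ^+ 2 * p + 2 * x * y * s + y ^+ 2 * r) by ring.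
  have -> : 256 * p ^+ 2 = 4 * p * (64 * p) by ring.
  by rewrite ltr_pM2l // mulr_gt0.
have h2 : p ^+ 2 <= 4 * p * r - 4 * s ^+ 2.
  have s2 : (2 * `|s|) ^+ 2 <= p ^+ 2 by rewrite lerXn2r ?nnegrE ?mulr_ge0 // ltW.
  have -> : 4 * s ^+ 2 = (2 * `|s|) ^+ 2 by rewrite exprMn real_normK ?num_real.
  have pr : p * p <= p * (2 * r) by rewrite ler_pM2l.
  lia.
have e16 : (16 * p) ^+ 2 = 256 * p ^+ 2 by ring.
have h3 : (y * p) ^+ 2 < (16 * p) ^+ 2.
  rewrite e16 exprMn; apply: le_lt_trans h1; apply: le_trans (ler_wpM2l (sqr_ge0 y) h2) _.
  by rewrite lerDr sqr_ge0.
have h4 : (2 * x * p + 2 * y * s) ^+ 2 < (16 * p) ^+ 2.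
  rewrite e16; apply: le_lt_trans h1; rewrite lerDl mulr_ge0 ?sqr_ge0 //.
  by apply: le_trans h2; rewrite sqr_ge0.
have p16 : 0 <= 16 * p by rewrite mulr_ge0 // ltW.
clear h h1 h2 e16 hr.
have h5 : `|y| <= 15.
  have := norm_lt_of_sqr p16 h3.
  by rewrite normrM (gtr0_norm p0) ltr_pM2r //; lia.
split=> //; have h6 := norm_lt_of_sqr p16 h4; clear h3 h4.
have h7 : `|2 * x| * p < 32 * p.
  have : `|2 * y * s| <= 15 * p.
    have -> : `|2 * y * s| = `|y| * (2 * `|s|) by rewrite !normrM normr_nat; ring.
    by rewrite ler_pM.
  have -> : `|2 * x| * p = `|2 * x * p| by rewrite [RHS]normrM (gtr0_norm p0).
  lia.
by move: h7; rewrite ltr_pM2r //; lia.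
Qed.

Lemma basis_coord (b1 b2 u : pt) : `|det2 b1 b2| = 1 ->
  exists x y, u = lin x y b1 b2.
Proof.
move=> h; have e : det2 b1 b2 * det2 b1 b2 = 1.
  by rewrite -expr2 -real_normK ?num_real // h.
exists (det2 b1 b2 * det2 u b2), (det2 b1 b2 * det2 b1 u).
have [e1 e2] := det2_cramer b1 b2 u.
rewrite /lin; case: u e1 e2 => u1 u2 /= e1 e2; congr pair.
  by rewrite -!mulrA -mulrDr -e1 mulrA e mul1r.
by rewrite -!mulrA -mulrDr -e2 mulrA e mul1r.
Qed.
End Reduced.

(* When [det2 u (b - v)] and [det2 (a - v) u] have opposite signs, the longest
   chord of the triangle in direction [u] starts from [a] or [b] instead. *)
Lemma reach_triangle (u v a b : pt) : area v a b != 0 -> u != 0 ->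
  exists v' a' b' : pt,
    [/\ v' \in [:: v; a; b], a' \in [:: v; a; b], b' \in [:: v; a; b]
      & (`|area v a b| %/ (`|det2 u (b - v)%R| + `|det2 (a - v)%R u|) <=
         reach u v' a' b')%N].
Proof.
move=> D0 u0; set k := (_ %/ _)%N.
have hk : (k * (`|det2 u (b - v)%R| + `|det2 (a - v)%R u|) <= `|area v a b|)%N.
  exact: leq_divM.
have [h|h] := lerP 0 (det2 u (b - v) * det2 (a - v) u).
  exists v, a, b; split; rewrite ?inE ?eqxx ?orbT //; apply: reach_ge => //.
  apply: leq_trans hk; rewrite leq_mul2l; lia.
have eb : area b a v = - area v a b by rewrite /area /det2 /=; ring.
have ea : area a b v = area v a b by rewrite /area /det2 /=; ring.
have [hab|hab] := lerP `|det2 u (b - v)%R| `|det2 (a - v)%R u|.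
- exists b, a, v; split; rewrite ?inE ?eqxx ?orbT //; apply: reach_ge => //.
  + by rewrite eb oppr_eq0.
  + have -> : det2 u (v - b) = - det2 u (b - v) by rewrite /det2 /=; ring.
    have -> : det2 (a - b) u = det2 (a - v) u + det2 u (b - v) by rewrite /det2 /=; ring.
    nia.
  + have -> : det2 u (v - b) + det2 (a - b) u = det2 (a - v) u by rewrite /det2 /=; ring.
    by rewrite eb abszN; apply: leq_trans hk; rewrite leq_mul2l; lia.
- exists a, b, v; split; rewrite ?inE ?eqxx ?orbT //; apply: reach_ge => //.
  + by rewrite ea.
  + have -> : det2 u (v - a) = det2 (a - v) u by rewrite /det2 /=; ring.
    have -> : det2 (b - a) u = - (det2 (a - v) u + det2 u (b - v)) by rewrite /det2 /=; ring.
    nia.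
  + have -> : det2 u (v - a) + det2 (b - a) u = - det2 u (b - v) by rewrite /det2 /=; ring.
    by rewrite ea abszN; apply: leq_trans hk; rewrite leq_mul2l; lia.
Qed.

(** * Coefficients of the directions of maximal reach *)

Section Candidates.
Variables (vs : seq pt) (v a b : pt).
Hypotheses (hv : v \in vs) (ha : a \in vs) (hb : b \in vs).
Hypothesis D0 : area v a b != 0.
Hypothesis Dmax : forall v' a' b', v' \in vs -> a' \in vs -> b' \in vs ->
  (`|area v' a' b'| <= `|area v a b|)%N.

Let A := a - v.
Let B := b - v.
Let D := `|area v a b|%N.

(** Each determinant is a difference of two areas of triangles that share a side with the maximal
    one, and each of these areas is at most [D]. *)
Lemma det2_diff_le (p q : pt) : p \in vs -> q \in vs ->
  (`|det2 (p - q)%R B| <= 2 * D)%N /\ (`|det2 A (p - q)%R| <= 2 * D)%N.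
Proof.
move=> hp hq.
have h1 := Dmax hv hp hb; have h2 := Dmax hv hq hb.
have h3 := Dmax hv ha hp; have h4 := Dmax hv ha hq.
have -> : det2 (p - q) B = area v p b - area v q b by rewrite /area /det2 /B /=; ring.
have -> : det2 A (p - q) = area v a p - area v a q by rewrite /area /det2 /A /=; ring.
rewrite /D; lia.
Qed.

(** The vector [k * u] combines [q - p] and [r - p] with weights of equal sign whose absolute values
    sum to at most 1, and on differences of vertices the linear forms [det2 _ B] and [det2 A _] are
    at most [2 * D]. Multiplying by the area [E] of [p q r] keeps the computation in the
    integers. *)
Lemma reach_det2_le (u p q r : pt) : p \in vs -> q \in vs -> r \in vs ->
  (reach u p q r * `|det2 u B| <= 2 * D)%N /\
  (reach u p q r * `|det2 A u| <= 2 * D)%N.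
Proof.
move=> hp hq hr; have [->|k0] := posnP (reach u p q r); first by rewrite !mul0n.
have [E0 s0 _] := reach_gt0 k0; have hk := reach_bound u p q r.
have [q1 q2] := det2_diff_le hq hp; have [r1 r2] := det2_diff_le hr hp.
have e1 : area p q r * det2 u B =
  det2 u (r - p) * det2 (q - p) B + det2 (q - p) u * det2 (r - p) B.
  by rewrite /area /det2 /=; ring.
have e2 : area p q r * det2 A u =
  det2 u (r - p) * det2 A (q - p) + det2 (q - p) u * det2 A (r - p).
  by rewrite /area /det2 /=; ring.
move: e1 e2 q1 q2 r1 r2 s0 hk k0 E0.
move: (area p q r) (reach u p q r) (det2 u (r - p)) (det2 (q - p) u).
move: (det2 (q - p) B) (det2 (r - p) B) (det2 A (q - p)) (det2 A (r - p)).
move=> w x y z E k al be e1 e2 q1 q2 r1 r2 s0 hk k0 E0.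
have sab : (`|(al + be)%R| = `|al| + `|be|)%N by nia.
have E1 : (0 < `|E|)%N by rewrite absz_gt0.
have gen g w' x' : E * g = al * w' + be * x' ->
  (`|w'| <= 2 * D)%N -> (`|x'| <= 2 * D)%N -> (k * `|g| <= 2 * D)%N.
  move=> eg hw hx; rewrite -(leq_pmul2l E1) mulnCA -abszM eg.
  have h1 : (`|(al * w' + be * x')%R| <= (`|al| + `|be|) * (2 * D))%N.
    have : (`|(al * w' + be * x')%R| <= `|al| * `|w'| + `|be| * `|x'|)%N.
      by rewrite -!abszM absz_addle.
    by move/leq_trans; apply; rewrite mulnDl leq_add ?leq_mul2l ?hw ?hx ?orbT.
  rewrite sab in hk.
  apply: (@leq_trans (k * ((`|al| + `|be|) * (2 * D)))%N); first by rewrite leq_mul2l h1 orbT.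
  by rewrite mulnA leq_mul2r hk orbT.
by split; [apply: (gen _ w x)|apply: (gen _ y z)].
Qed.

Section Basis.
Variables b1 b2 : pt.
Hypothesis b_det : `|det2 b1 b2| = 1.
Hypothesis b_dot : 2 * `|qdot A B b1 b2| <= qform A B b1.
Hypothesis b_len : qform A B b1 <= 2 * qform A B b2.

Lemma basis_neq0 : b1 != 0.
Proof.
by apply: contra_eq_neq b_det => ->; rewrite /det2 /= !mul0r subrr normr0.
Qed.

(** Squaring and adding [reach_det2_le] gives [k^2 * qform u <= 8 * D^2]. Since [b1] has reach at
    most [k] from the corners of the maximal triangle, [D < 2k (|s| + |t|)] for its determinants
    [s], [t], whence [D^2 < 8 k^2 * qform b1]. Together these are the factor 64 of
    [reduced_coef]. *)
Lemma reach_max_coef (u p q r : pt) :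
  p \in vs -> q \in vs -> r \in vs -> (0 < reach u p q r)%N ->
  (forall u' p' q' r', p' \in vs -> q' \in vs -> r' \in vs ->
     (reach u' p' q' r' <= reach u p q r)%N) ->
  exists x y, [/\ `|x| <= 15, `|y| <= 15 & u = lin x y b1 b2].
Proof.
move=> hp hq hr k0 kmax; have [x [y eu]] := basis_coord u b_det.
exists x, y; suff [] : `|x| <= 15 /\ `|y| <= 15 by [].
have q1 : 0 < qform A B b1 by rewrite qform_gt0 // basis_neq0.
apply: (reduced_coef q1 b_dot b_len); rewrite -eu.
have [l1 l2] := reach_det2_le u hp hq hr.
have sub z : z \in [:: v; a; b] -> z \in vs.
  by rewrite !inE => /or3P[] /eqP->.
have [v' [a' [b' [hv' ha' hb' hS]]]] := reach_triangle D0 basis_neq0.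
have {hS} := leq_trans hS (kmax b1 _ _ _ (sub _ hv') (sub _ ha') (sub _ hb')).
rewrite -ltnS ltn_divLR => [hS|]; last first.
  rewrite addn_gt0 !absz_gt0 -negb_and; apply: contraTN q1 => /andP[/eqP z1 /eqP z2].
  by rewrite /qform /qdot z1 z2 mulr0 ltxx.
rewrite -/D -/A -/B in hS.
(* Undoing the integer division costs [k + 1], which is at most [2 * k] because [k] is positive. *)
have {}hS : (D < 2 * reach u p q r * (`|det2 b1 B| + `|det2 A b1|))%N.
  by apply: leq_trans hS _; rewrite leq_mul2r; lia.
move: hS l1 l2 k0; rewrite /qform /qdot.
move: D (reach u p q r) (det2 b1 B) (det2 A b1) (det2 u B) (det2 A u) => d k s t w z.
clear => hS l1 l2 k0.
have m1 := leq_mul l1 l1; have m2 := leq_mul l2 l2; have m3 := leq_mul hS hS.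
have k2 : (0 < k * k)%N by rewrite muln_gt0 k0.
have hst : (2 * (`|s| * `|t|) <= `|s| * `|s| + `|t| * `|t|)%N.
  by have := (nat_Cauchy `|s| `|t|).1; rewrite !mulnn.
have n1 : (k * k * (`|w| * `|w| + `|z| * `|z|) <= 8 * (d * d))%N.
  by move: m1 m2; rewrite -!mulnA; lia.
have n2 : (d * d < 8 * (k * k) * (`|s| * `|s| + `|t| * `|t|))%N.
  apply: (@leq_trans (4 * (k * k) * ((`|s| + `|t|) * (`|s| + `|t|)))%N).
    by move: m3; rewrite mulSn mulnS; lia.
  rewrite (_ : 8 = 4 * 2)%N // -![(4 * _ * _)%N]mulnA [(2 * _)%N]mulnC -!mulnA.
  by rewrite !leq_mul2l /=; apply/orP; right; lia.
have n3 : (`|w| * `|w| + `|z| * `|z| < 64 * (`|s| * `|s| + `|t| * `|t|))%N.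
  by rewrite -(ltn_pmul2l k2); lia.
lia.
Qed.

(* The indices [16 <= c < 496] enumerate the pairs of coefficients [(x, y)] with
   [|x|, |y| <= 15] and [y > 0], or [y = 0] and [x > 0]. *)
Definition cand (c : nat) : pt := lin ((c %% 31)%N%:Z - 15) (c %/ 31)%N%:Z b1 b2.

Lemma lin_cand (u : pt) x y : u != 0 -> `|x| <= 15 -> `|y| <= 15 ->
  u = lin x y b1 b2 ->
  exists2 c : nat, (16 <= c < 496)%N & u = cand c \/ - u = cand c.
Proof.
move=> u0 hx hy eu.
wlog hpos : u x y u0 hx hy eu / (0 < y) || (y == 0) && (0 < x).
  move=> W; case hP : ((0 < y) || (y == 0) && (0 < x)); first exact: (W u x y).
  have [] := W (- u) (- x) (- y).
  - by rewrite oppr_eq0.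
  - by rewrite normrN.
  - by rewrite normrN.
  - by rewrite eu /lin; congr pair; rewrite /=; ring.
  - have : (x != 0) || (y != 0).
      rewrite -negb_and; apply: contra_neqN u0 => /andP[/eqP z1 /eqP z2].
      by rewrite eu z1 z2 /lin !mul0r addr0.
    by move: hP; lia.
  by move=> c hc; rewrite opprK => h; exists c => //; tauto.
exists (31 * `|y| + `|(x + 15)%R|)%N; first by move: hpos; lia.
left; rewrite eu /cand mulnC modnMDl divnMDl // modn_small ?divn_small ?addn0; try lia.
by congr lin; lia.
Qed.

Lemma cand_all best u p q r : (0 < best)%N ->
  (forall u' p' q' r', p' \in vs -> q' \in vs -> r' \in vs ->
     (reach u' p' q' r' <= best)%N) ->
  p \in vs -> q \in vs -> r \in vs -> reach u p q r = best ->
  exists2 c : nat, (16 <= c < 496)%N & u = cand c \/ - u = cand c.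
Proof.
move=> k0 kmax hp hq hr eb; rewrite -eb in k0 kmax.
have [x [y [hx hy eu]]] := reach_max_coef hp hq hr k0 kmax.
apply: lin_cand hx hy eu; have [_ _] := reach_gt0 k0.
by apply: contra_neq => ->; rewrite /det2 /= !mulr0 !mul0r !subr0.
Qed.

(** The reach of every direction is at most [D], so a maximum over the infinitely many directions
    exists. By [cand_all] it is attained, up to sign, at a candidate. *)
Lemma cand_max best :
  (forall c p q r, (16 <= c < 496)%N -> p \in vs -> q \in vs -> r \in vs ->
     (reach (cand c) p q r <= best)%N) ->
  forall u p q r, p \in vs -> q \in vs -> r \in vs -> (reach u p q r <= best)%N.
Proof.
move=> hbest; pose E k := `[< exists u p q r, [/\ p \in vs, q \in vs, r \in vs & reach u p q r = k] >].
have E0 : exists k, E k by exists (reach 0 v v v); apply/asboolP; exists 0, v, v, v.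
have Eb k : E k -> (k <= D)%N.
  move=> /asboolP[u [p [q [r [hp hq hr <-]]]]]; have [->//|k0] := posnP (reach u p q r).
  have [_ _ s0] := reach_gt0 k0; apply: leq_trans (Dmax hp hq hr).
  by apply: leq_trans (reach_bound u p q r); rewrite leq_pmulr // absz_gt0.
case: (ex_maxnP E0 Eb) => k /asboolP[u [p [q [r [hp hq hr ek]]]]] kmax.
have {}kmax u' p' q' r' : p' \in vs -> q' \in vs -> r' \in vs -> (reach u' p' q' r' <= k)%N.
  by move=> *; apply: kmax; apply/asboolP; exists u', p', q', r'.
suff hk : (k <= best)%N by move=> *; apply: leq_trans hk; apply: kmax.
have [->//|k0] := posnP k.
have [c hc hu] := cand_all k0 kmax hp hq hr ek.
have <- : reach (cand c) p q r = k by case: hu => <-; rewrite ?reachN.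
exact: hbest.
Qed.

Lemma reach_pos : (0 < reach A v a b)%N.
Proof.
rewrite /reach /area -/A -/B (_ : det2 A A = 0) ?mulr0 ?ltxx ?addr0.
  by rewrite divnn absz_gt0 D0.
by rewrite /det2; ring.
Qed.

Lemma cand_inj c c' : (16 <= c < 496)%N -> (16 <= c' < 496)%N ->
  cand c = cand c' \/ cand c = - cand c' -> c = c'.
Proof.
move=> hc hc' h.
have linI x y x' y' : lin x y b1 b2 = lin x' y' b1 b2 -> x = x' /\ y = y'.
  have d0 : det2 b1 b2 != 0 by rewrite -normr_gt0 b_det.
  case=> e1 e2; split; apply: (mulfI d0); rewrite /det2.
    transitivity ((x * b1.1 + y * b2.1) * b2.2 - (x * b1.2 + y * b2.2) * b2.1); first ring.
    by rewrite e1 e2; ring.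
  transitivity (b1.1 * (x * b1.2 + y * b2.2) - b1.2 * (x * b1.1 + y * b2.1)); first ring.
  by rewrite e1 e2; ring.
have ec := divn_eq c 31; have ec' := divn_eq c' 31.
case: h; rewrite /cand.
  by move=> /linI[]; lia.
have -> x y : - lin x y b1 b2 = lin (- x) (- y) b1 b2.
  by rewrite /lin; congr pair; rewrite /=; ring.
by move=> /linI[]; lia.
Qed.

End Basis.
End Candidates.

(** * Convexity *)

Section Convexity.
Local Open Scope classical_set_scope.
Local Open Scope ring_scope.

Variables (R : realType) (d : nat).
Implicit Types (S E : set 'rV[R]_d) (x y p : 'rV[R]_d).

Lemma sub_conv S x : S x -> conv S x.
Proof.
move=> hx; exists 1%N, (fun=> 1), (fun=> x); split=> //.
  by rewrite big_ord1.
by rewrite big_ord1 scale1r.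
Qed.

Lemma conv_convex S x y (t : R) : 0 <= t <= 1 -> conv S x -> conv S y ->
  conv S (t *: x + (1 - t) *: y).
Proof.
move=> /andP[t0 t1] [n [a [p [a0 a1 hp ->]]]] [n' [a' [p' [a0' a1' hp' ->]]]].
exists (n + n')%N,
  (fun i => match split i with inl j => t * a j | inr j => (1 - t) * a' j end),
  (fun i => match split i with inl j => p j | inr j => p' j end); split.
- by move=> i; case: (split i) => j; rewrite mulr_ge0 ?subr_ge0.
- rewrite big_split_ord /=.
  under eq_bigr => i _ do rewrite (unsplitK (inl i)).
  under [X in _ + X]eq_bigr => i _ do rewrite (unsplitK (inr i)).
  by rewrite -!mulr_sumr a1 a1' !mulr1 subrKC.
- by move=> i; case: (split i).
- rewrite big_split_ord /= !scaler_sumr; congr (_ + _); apply: eq_bigr => i _.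
    by rewrite (unsplitK (inl i)) scalerA.
  by rewrite (unsplitK (inr i)) scalerA.
Qed.

(** A convex combination is built by adding one generator at a time: the first point is split off
    and the remaining weights are divided by their sum. *)
Lemma conv_ind S E :
  (forall p, S p -> E p) ->
  (forall (t : R) p x, 0 <= t <= 1 -> S p -> E x -> E (t *: p + (1 - t) *: x)) ->
  forall x, conv S x -> E x.
Proof.
move=> hS hE x [n [a [p [a0 a1 hp ->]]]].
elim: n a p a0 a1 hp => [|n IH] a p a0 a1 hp.
  by move: a1; rewrite big_ord0 => /eqP; rewrite eq_sym oner_eq0.
move: a1; rewrite !big_ord_recl => a1.
have s0 : 0 <= \sum_(i < n) a (lift ord0 i) by apply: sumr_ge0.
(* If the remaining weights sum to 0 they cannot be normalized, but then all of them vanish. *)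
have [z|nz] := eqVneq (\sum_(i < n) a (lift ord0 i)) 0.
  move: a1; rewrite z addr0 => ->; rewrite scale1r big1 ?addr0; first exact: hS.
  move=> i _; move/eqP: z; rewrite psumr_eq0 // => /allP/(_ i).
  by rewrite mem_index_enum => /(_ isT)/eqP ->; rewrite scale0r.
have e1 : \sum_(i < n) a (lift ord0 i) = 1 - a ord0 by rewrite -a1 addrC addKr.
have -> : \sum_(i < n) a (lift ord0 i) *: p (lift ord0 i) =
   (1 - a ord0) *: \sum_(i < n) (a (lift ord0 i) / (1 - a ord0)) *: p (lift ord0 i).
  rewrite scaler_sumr; apply: eq_bigr => i _; rewrite scalerA mulrC divfK //.
  by rewrite -e1.
apply: hE => //; first by rewrite a0 -a1 lerDl.
apply: IH => [i| |//]; first by rewrite divr_ge0 // -e1.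
by rewrite -mulr_suml e1 divff // -e1.
Qed.

Lemma conv_min S E :
  S `<=` E ->
  (forall (t : R) x y, 0 <= t <= 1 -> E x -> E y -> E (t *: x + (1 - t) *: y)) ->
  conv S `<=` E.
Proof. by move=> hS hE; apply: conv_ind => // t p x ht /hS; apply: hE. Qed.

Lemma conv_sub S S' : S `<=` conv S' -> conv S `<=` conv S'.
Proof. by move=> h; apply: conv_min => // *; apply: conv_convex. Qed.

Lemma conv2P x y z :
  conv [set x; y] z <-> exists2 t : R, 0 <= t <= 1 & z = t *: x + (1 - t) *: y.
Proof.
split=> [|[t ht ->]]; last by apply: conv_convex => //; apply: sub_conv; [left|right].
move: z; apply: conv_ind => [p [->|->]|t p z ht hp [s hs ->]].
- by exists 1; rewrite ?ler01 ?lexx // scale1r subrr scale0r addr0.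
- by exists 0; rewrite ?ler01 ?lexx // scale0r subr0 scale1r add0r.
case: hp => ->.
- exists (t + (1 - t) * s); first nra.
  by apply/rowP => i; rewrite !mxE; ring.
- exists ((1 - t) * s); first nra.
  by apply/rowP => i; rewrite !mxE; ring.
Qed.

Lemma aff2P x y z :
  aff [set x; y] z <-> exists t : R, z = x + t *: (y - x).
Proof.
split=> [[n [a [p [a1 hp ->]]]]|[t ->]].
  exists (\sum_(i < n) a i *+ (p i != x)); rewrite scaler_suml -[X in _ = X + _]scale1r -a1.
  rewrite scaler_suml -big_split; apply: eq_bigr => i _ /=.
  case: (hp i) => ->; first by rewrite eqxx mulr0n scale0r addr0.
  have [->|nxy] := eqVneq y x; first by rewrite mulr0n scale0r addr0.
  by rewrite mulr1n scalerBr subrKC.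
exists 2%N, (fun i => if i == ord0 then 1 - t else t),
  (fun i => if i == ord0 then x else y); split.
- by rewrite !big_ord_recl big_ord0 /= addr0 subrK.
- by move=> i; case: eqP => _; [left|right].
- by rewrite !big_ord_recl big_ord0 /= addr0 scalerBl scale1r scalerBr -addrA [- _ + _]addrC.
Qed.

Lemma conv_join S p x : conv (p |` S) x ->
  x = p \/ exists (t : R) q, [/\ 0 <= t < 1, conv S q & x = t *: p + (1 - t) *: q].
Proof.
move: x; apply: conv_ind => [x [->|hx]|t z x /andP[t0 t1] hz hx]; first by left.
  right; exists 0, x; split; [by rewrite lexx ltr01|exact: sub_conv|].
  by rewrite scale0r subr0 scale1r add0r.
have [->|tn1] := eqVneq t 1.
  rewrite scale1r subrr scale0r addr0; case: hz => [->|hz]; first by left.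
  right; exists 0, z; split; [by rewrite lexx ltr01|exact: sub_conv|].
  by rewrite scale0r subr0 scale1r add0r.
have {tn1 t1} t1 : t < 1 by rewrite lt_neqAle tn1.
case: hx => [->|[s [q [/andP[s0 s1] hq ->]]]].
  case: hz => [->|hz].
    by left; rewrite -scalerDl subrKC scale1r.
  have [->|tn0] := eqVneq t 0.
    by left; rewrite scale0r subr0 scale1r add0r.
  right; exists (1 - t), z; split; [|exact: sub_conv|].
    have : 0 < t by rewrite lt_def tn0.
    by lra.
  by rewrite addrC opprB subrKC.
right; case: hz => [->|hz].
  exists (t + (1 - t) * s), q; split=> //; first nra.
  by apply/rowP => i; rewrite !mxE; ring.
have s' : 0 < 1 - (1 - t) * s by nra.
exists ((1 - t) * s), ((t / (1 - (1 - t) * s)) *: z + (1 - t / (1 - (1 - t) * s)) *: q); split.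
- nra.
- apply: conv_convex => //; last exact: sub_conv.
  by rewrite divr_ge0 ?(ltW s') //= ler_pdivrMr // mul1r; nra.
- apply/rowP => i; rewrite !mxE; field; exact: lt0r_neq0.
Qed.

(** Suppose [p] lies strictly between [x] and [y]. After splitting off their shares [s] and [s'] of
    [p], the equation can be solved for [p], because its total share [c] on the right is below 1;
    this exhibits [p] as a combination of points of [conv S]. If [x] or [y] is [p] itself, then so
    is the other one. *)
Lemma conv_drop S p : conv (p |` S) p -> ~ vertex (conv (p |` S)) p -> conv S p.
Proof.
move=> hp nv; apply: contrapT => nS; apply: nv; split=> // x y t hx hy /andP[t0 t1] e.
have same z s : 0 < s -> p = s *: p + (1 - s) *: z -> s < 1 -> z = p.
  move=> s0 ez s1; apply: (@scalerI _ _ (1 - s)); first by rewrite subr_eq0 gt_eqF.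
  by rewrite [RHS]scalerBl scale1r [X in _ = X - _]ez addrAC subrr add0r.
case: (conv_join hx) => [ex|[s [q [/andP[s0 s1] hq ex]]]].
  by split=> //; rewrite ex in e; apply: same e t1.
case: (conv_join hy) => [ey|[s' [q' [/andP[s0' s1'] hq' ey]]]].
  split=> //; apply: (@same _ (1 - t)); [lra| |lra].
  by rewrite opprB subrKC addrC {1}e ey.
case: nS; set c := t * s + (1 - t) * s'.
have c1 : 0 < 1 - c by rewrite /c; nra.
have -> : p = (t * (1 - s) / (1 - c)) *: q + (1 - t * (1 - s) / (1 - c)) *: q'.
  apply: (@scalerI _ _ (1 - c)); first exact: lt0r_neq0.
  have -> : (1 - c) *: p = (t * (1 - s)) *: q + ((1 - t) * (1 - s')) *: q'.
    rewrite scalerBl scale1r {1}e ex ey /c; apply/rowP => i; rewrite !mxE; ring.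
  by apply/rowP => i; rewrite !mxE /c; field; rewrite -/c lt0r_neq0.
apply: conv_convex => //; apply/andP; split.
  by apply: divr_ge0; [nra|exact: ltW].
by rewrite ler_pdivrMr // mul1r /c; nra.
Qed.

(** Generators that are not extreme are deleted by [conv_drop], all copies of a point at once, until
    only vertices are left. *)
Lemma polytope_vertices (P : set ('rV[R]_d)) : polytope P -> P = conv (vertex P).
Proof.
move=> [s hs]; apply/seteqP; split; last first.
  apply: conv_min => [x []//|t x y ht]; rewrite hs; exact: conv_convex.
elim: {s}(size s) {-2}s (leqnn (size s)) hs => [|n IH] s hn hs.
  move: hn; rewrite leqn0 => /nilP s0; rewrite hs s0.
  by move=> x [[|k] [a [p [_ a1 hp _]]]]; [move: a1; rewrite big_ord0 => /eqP; rewrite eq_sym oner_eq0|have := hp ord0].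
have [hv|/existsNP[p /not_implyP[ps nv]]] := pselect (forall p, p \in s -> vertex P p).
  by rewrite {1}hs; apply: conv_sub => x hx; apply: sub_conv; apply: hv.
pose s' := filter (predC1 p) s.
have es : [set` s] = p |` [set` s'].
  apply/seteqP; split=> x /=; rewrite mem_filter /=.
    by have [->|] := eqVneq x p; [left|right].
  by move=> [->//|/andP[]].
apply: (IH s').
  rewrite -ltnS; apply: leq_trans hn; rewrite size_filter -(count_predC (pred1 p) s) addnC.
  by rewrite -[X in (X < _)%N]addn0 ltn_add2l -has_count has_pred1.
rewrite hs es; apply/seteqP; split; apply: conv_sub => x.
  case=> [->|hx]; last exact: sub_conv.
  rewrite hs es in nv; apply: conv_drop nv; exact/sub_conv/or_introl.
by move=> hx; apply/sub_conv/or_intror.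
Qed.

End Convexity.

(** * Chords of planar polytopes *)

Section Plane.
Local Open Scope classical_set_scope.
Local Open Scope ring_scope.

Variable R : realType.
Implicit Types (S : set 'rV[R]_2) (u v w x y p q : 'rV[R]_2).

Definition detR u v : R := u 0 0 * v 0 1 - u 0 1 * v 0 0.

Lemma row2P u v : u 0 0 = v 0 0 -> u 0 1 = v 0 1 -> u = v.
Proof.
move=> h0 h1; apply/rowP => -[[|[|//]] hi].
  by rewrite (_ : Ordinal hi = 0) //; apply: val_inj.
by rewrite (_ : Ordinal hi = 1) //; apply: val_inj.
Qed.

Lemma detR_lin w (s t : R) x y : detR w (s *: x + t *: y) = s * detR w x + t * detR w y.
Proof. by rewrite /detR !mxE; ring. Qed.

Lemma detR_parallel w x : w != 0 -> detR w x = 0 -> exists c : R, x = c *: w.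
Proof.
move=> w0 h; have [z0|n0] := eqVneq (w 0 0) 0; last first.
  exists (x 0 0 / w 0 0); apply: row2P; rewrite !mxE ?divfK //.
  apply: (mulfI n0); move: h; rewrite /detR => /eqP; rewrite subr_eq0 => /eqP ->.
  by field.
have n1 : w 0 1 != 0.
  by apply: contra_neq w0 => z1; apply: row2P; rewrite !mxE.
exists (x 0 1 / w 0 1); apply: row2P; rewrite !mxE ?divfK //.
apply: (mulfI n1); move: h; rewrite /detR z0 mul0r sub0r => /eqP; rewrite oppr_eq0.
by move/eqP ->; rewrite !mulr0.
Qed.

(* The exchange step of Caratheodory's theorem. *)
Lemma exchange n (l m : 'I_n -> R) (i0 : 'I_n) :
  (forall i, 0 <= l i) -> m i0 < 0 ->
  exists t, [/\ 0 <= t, forall i, 0 <= l i + t * m i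
                & exists i, l i + t * m i = 0].
Proof.
move=> l0 m0; have [i /= mi imin] := @arg_minP _ _ _ i0 (fun i => m i < 0) (fun i => l i / - m i) m0.
exists (l i / - m i); split.
- by rewrite divr_ge0 // oppr_ge0 ltW.
- move=> j; have [mj|mj] := leP 0 (m j).
    by rewrite addr_ge0 // mulr_ge0 // divr_ge0 // oppr_ge0 ltW.
  have := imin j mj; rewrite ler_pdivlMr ?oppr_gt0 // mulrN.
  by rewrite lerNl -subr_ge0 opprK addrC.
- by exists i; field; rewrite lt_eqF.
Qed.

Lemma exists_neg n (m : 'I_n -> R) : \sum_i m i = 0 -> (exists i, m i != 0) ->
  exists i, m i < 0.
Proof.
move=> s0 [j mj]; apply: contrapT => /forallNP h.
have m0 i : 0 <= m i by rewrite leNgt; apply/negP; apply: h.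
move/eqP: s0; rewrite psumr_eq0 // => /allP/(_ j).
by rewrite mem_index_enum (negPf mj) => /(_ isT).
Qed.

Definition vec3 (a b c : R) : 'I_3 -> R := fun i => [:: a; b; c]`_i.
Definition vec4 (a b c e : R) : 'I_4 -> R := fun i => [:: a; b; c; e]`_i.

Lemma forall3 (P : 'I_3 -> Prop) : P 0 -> P 1 -> P (inord 2) -> forall i, P i.
Proof.
move=> h0 h1 h2 [[|[|[|//]]] hi].
- by rewrite (_ : Ordinal hi = 0) //; apply: val_inj.
- by rewrite (_ : Ordinal hi = 1) //; apply: val_inj.
- by rewrite (_ : Ordinal hi = inord 2) //; apply: val_inj; rewrite /= inordK.
Qed.

(* Exchange along an affine dependency that preserves [detR w]. *)
Lemma triangle_exit w q1 q2 q3 (l1 l2 l3 : R) : w != 0 ->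
  0 <= l1 -> 0 <= l2 -> 0 <= l3 -> l1 + l2 + l3 = 1 ->
  exists (c l1' l2' l3' : R),
  [/\ 0 <= c,
      [/\ 0 <= l1', 0 <= l2', 0 <= l3' & l1' + l2' + l3' = 1],
      l1' = 0 \/ l2' = 0 \/ l3' = 0
    & l1' *: q1 + l2' *: q2 + l3' *: q3 = l1 *: q1 + l2 *: q2 + l3 *: q3 + c *: w].
Proof.
move=> w0 p1 p2 p3 s1.
suff [m1 [m2 [m3 [c [c0 sm mn em]]]]] : exists m1 m2 m3 c : R,
   [/\ 0 <= c, m1 + m2 + m3 = 0, (m1 != 0) || (m2 != 0) || (m3 != 0)
    & m1 *: q1 + m2 *: q2 + m3 *: q3 = c *: w].
  have [||i mi] := @exists_neg 3 (vec3 m1 m2 m3).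
  - by rewrite !big_ord_recl big_ord0 /vec3 /= addr0 addrA.
  - case/orP: mn => [/orP[]|] h; [exists 0|exists 1|exists (inord 2)] => //.
    by rewrite /vec3 inordK.
  have [|t [t0 tl [j tj]]] := @exchange 3 (vec3 l1 l2 l3) _ i _ mi.
    by apply: forall3; rewrite /vec3 ?inordK.
  exists (t * c), (l1 + t * m1), (l2 + t * m2), (l3 + t * m3); split.
  - exact: mulr_ge0.
  - split; [exact: (tl 0)|exact: (tl 1)| |].
      by have := tl (inord 2); rewrite /vec3 inordK.
    by transitivity (l1 + l2 + l3 + t * (m1 + m2 + m3)); [ring|rewrite sm s1; ring].
  - move: j tj; apply: forall3; rewrite /vec3 ?inordK //=; tauto.
  - rewrite -scalerA -em; apply/rowP => k; rewrite !mxE; ring.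
have neg m1 m2 m3 c : m1 + m2 + m3 = 0 -> (m1 != 0) || (m2 != 0) || (m3 != 0) ->
   m1 *: q1 + m2 *: q2 + m3 *: q3 = c *: w -> exists m1 m2 m3 c : R,
   [/\ 0 <= c, m1 + m2 + m3 = 0, (m1 != 0) || (m2 != 0) || (m3 != 0)
    & m1 *: q1 + m2 *: q2 + m3 *: q3 = c *: w].
  move=> sm mn em; have [c0|c0] := leP 0 c; first by exists m1, m2, m3, c.
  exists (- m1), (- m2), (- m3), (- c); split; rewrite ?oppr_eq0 //.
  - by rewrite oppr_ge0 ltW.
  - by rewrite -!opprD sm oppr0.
  - by rewrite !scaleNr -!opprD em.
have par m1 m2 m3 : m1 * detR w q1 + m2 * detR w q2 + m3 * detR w q3 = 0 ->
    exists c : R, m1 *: q1 + m2 *: q2 + m3 *: q3 = c *: w.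
  move=> h; apply: detR_parallel => //; rewrite -h.
  by rewrite -[_ + m3 *: q3]/(_ + _) -[X in X + m3 *: _]scale1r !detR_lin; ring.
(* The cyclic differences of the values of [detR w] sum to 0 and cancel in [detR w], so they form
   the wanted dependency unless all vanish; in that case [q1 - q2] is itself parallel to [w]. *)
case: (boolP [&& detR w q2 == detR w q3, detR w q3 == detR w q1 & detR w q1 == detR w q2]).
  move=> /and3P[/eqP e1 /eqP e2 _].
  have [|c ec] := par 1 (-1) 0; first by rewrite e1 e2; ring.
  apply: neg ec; last by rewrite oner_eq0.
  by rewrite subrr addr0.
move=> h; have [|c ec] := par (detR w q2 - detR w q3) (detR w q3 - detR w q1) (detR w q1 - detR w q2).
  by ring.
apply: neg ec; first by ring.
by rewrite !subr_eq0 -!negb_and -andbA.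
Qed.

(** Moving far enough along [w], one meets a segment between two points of [S]. Each further
    generator produces a triangle, and [triangle_exit] moves on along [w] until one of its three
    corners is free again. *)
Lemma conv_exit S w x : w != 0 -> conv S x ->
  exists q o (s c : R), [/\ S q, S o, 0 <= s <= 1, 0 <= c
                         & s *: q + (1 - s) *: o = x + c *: w].
Proof.
move=> w0; move: x; apply: conv_ind => [p hp|t p x ht hp [q [o [s [c [hq ho hs c0 e]]]]]].
  exists p, p, 1, 0; split; rewrite ?ler01 ?lexx //.
  by rewrite subrr !scale0r scale1r.
have [||||c' [l1 [l2 [l3 [c0' [p1 p2 p3 sl] z el]]]]] :=
  @triangle_exit w p q o t ((1 - t) * s) ((1 - t) * (1 - s)) w0; [nra|nra|nra|ring|].
have {}el : l1 *: p + l2 *: q + l3 *: o = t *: p + (1 - t) *: x + (c' + (1 - t) * c) *: w.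
  have ex : x = s *: q + (1 - s) *: o - c *: w by rewrite e addrK.
  rewrite el ex; apply/rowP => k; rewrite !mxE; ring.
have cc : 0 <= c' + (1 - t) * c by nra.
case: z => [z|[z|z]]; rewrite z ?scale0r ?add0r ?addr0 in el sl.
- exists q, o, l2, (c' + (1 - t) * c); split=> //; first by lra.
  by rewrite -el (_ : 1 - l2 = l3) //; lra.
- exists p, o, l1, (c' + (1 - t) * c); split=> //; first by lra.
  by rewrite -el (_ : 1 - l1 = l3) //; lra.
- exists p, q, l1, (c' + (1 - t) * c); split=> //; first by lra.
  by rewrite -el (_ : 1 - l1 = l2) //; lra.
Qed.

(* Sliding a chord between two segments in the direction in which it does not
   shrink, until one of its ends reaches an end of its segment. *)
Lemma slide w q o p r (s t m : R) : w != 0 -> 0 <= s <= 1 -> 0 <= t <= 1 -> 1 <= m ->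
  t *: p + (1 - t) *: r = s *: q + (1 - s) *: o + m *: w ->
  exists s' t' m' : R,
  [/\ 0 <= s' <= 1, 0 <= t' <= 1, 1 <= m',
      [\/ s' = 0, s' = 1, t' = 0 | t' = 1]
    & t' *: p + (1 - t') *: r = s' *: q + (1 - s') *: o + m' *: w].
Proof.
move=> w0 hs ht hm e.
suff [m1 [m2 [c [c0 mn em]]]] : exists m1 m2 c : R,
   [/\ 0 <= c, (m1 != 0) || (m2 != 0) & m2 *: (p - r) - m1 *: (q - o) = c *: w].
  have [||i mi] := @exists_neg 4 (vec4 m1 (- m1) m2 (- m2)).
  - by rewrite !big_ord_recl big_ord0 /vec4 /=; ring.
  - case/orP: mn => h; [by exists 0|exists (inord 2)].
    by rewrite /vec4 inordK.
  have [|a [a0 al [j aj]]] := @exchange 4 (vec4 s (1 - s) t (1 - t)) _ i _ mi.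
    by move=> [[|[|[|[|//]]]] hi]; rewrite /vec4 /=; lra.
  have b0 := al 0; have b1 := al 1; have b2 := al (inord 2); have b3 := al (inord 3).
  rewrite /vec4 ?inordK //= in b0 b1 b2 b3.
  exists (s + a * m1), (t + a * m2), (m + a * c); split.
  - by lra.
  - by lra.
  - by have := mulr_ge0 a0 c0; lra.
  - move: j aj {mi al} => [[|[|[|[|//]]]] hi]; rewrite /vec4 /= => ej.
    + by apply: Or41.
    + by apply: Or42; lra.
    + by apply: Or43.
    + by apply: Or44; lra.
  - have -> : (m + a * c) *: w = m *: w + a *: (c *: w) by rewrite scalerA scalerDl.
    have -> : m *: w = t *: p + (1 - t) *: r - (s *: q + (1 - s) *: o) by rewrite e addrC addKr.
    by rewrite -em; apply/rowP => k; rewrite !mxE; ring.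
have neg m1 m2 c : (m1 != 0) || (m2 != 0) ->
   m2 *: (p - r) - m1 *: (q - o) = c *: w -> exists m1 m2 c : R,
   [/\ 0 <= c, (m1 != 0) || (m2 != 0) & m2 *: (p - r) - m1 *: (q - o) = c *: w].
  move=> mn em; have [c0|c0] := leP 0 c; first by exists m1, m2, c.
  exists (- m1), (- m2), (- c); split; rewrite ?oppr_eq0 //.
  - by rewrite oppr_ge0 ltW.
  - by rewrite !scaleNr -em opprB opprK addrC.
have par m1 m2 : m2 * detR w (p - r) - m1 * detR w (q - o) = 0 ->
    exists c : R, m2 *: (p - r) - m1 *: (q - o) = c *: w.
  by move=> h; apply: detR_parallel => //; rewrite -scaleNr detR_lin -h; ring.
(* The chord stays parallel to [w] when the speeds satisfy [m2 * detR w (p - r) = m1 * detR w (q -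
   o)]. If both determinants vanish, both segments are parallel to [w] and it is enough to move one
   end. *)
have [z|nz] := boolP ((detR w (p - r) != 0) || (detR w (q - o) != 0)).
  have [|c ec] := par (detR w (p - r)) (detR w (q - o)); first by ring.
  exact: neg ec.
move: nz; rewrite negb_or !negbK => /andP[/eqP z1 /eqP z2].
have [|c ec] := par 1 0; first by rewrite z2; ring.
by apply: neg ec; rewrite oner_eq0.
Qed.

(** Both ends are pushed outwards, [x] along [- w] and [y] along [w], onto segments between points
    of [S]; the chord so obtained has factor [1 + c + c'] and is then slid. The sign of [m] records
    which of its ends has become the point [v] of [S]. *)
Lemma conv_chord S w x y : w != 0 -> conv S x -> conv S y -> y = x + w ->
  exists v p r (t m : R), [/\ [/\ S v, S p & S r], 0 <= t <= 1, 1 <= `|m|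
    & t *: p + (1 - t) *: r = v + m *: w].
Proof.
move=> w0 hx hy exy.
have wN0 : - w != 0 by rewrite oppr_eq0.
have [q [o [s [c [hq ho hs c0 eq]]]]] := conv_exit wN0 hx.
have [p [r [t [c' [hp hr ht c0' ep]]]]] := conv_exit w0 hy.
have [||s' [t' [m' [hs' ht' hm' hz e']]]] :=
  @slide w q o p r s t (1 + c + c') w0 hs ht; first by lra.
  rewrite ep eq exy; apply/rowP => k; rewrite !mxE; ring.
have nm : 1 <= `|m'| by apply: le_trans (ler_norm _).
have nm' : 1 <= `|- m'| by rewrite normrN.
case: hz e' => -> e'; rewrite ?scale0r ?scale1r ?subr0 ?subrr ?scale0r ?scale1r ?add0r ?addr0 in e'.
- by exists o, p, r, t', m'.
- by exists q, p, r, t', m'.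
- exists r, q, o, s', (- m'); split=> //.
  by rewrite e' scaleNr addrK.
- exists p, q, o, s', (- m'); split=> //.
  by rewrite e' scaleNr addrK.
Qed.

End Plane.

(** * Real chords of a lattice polygon measured by [reach] *)

Section LatticePolygon.
Local Open Scope classical_set_scope.
Local Open Scope ring_scope.

Variable R : realType.
Local Notation pnt := (@point R).

Lemma point0 v : pnt v 0 0 = v.1%:~R. Proof. by rewrite mxE. Qed.
Lemma point1 v : pnt v 0 1 = v.2%:~R. Proof. by rewrite mxE. Qed.

Lemma point_inj : injective pnt.
Proof.
move=> [a b] [c d] e; have := congr1 (fun x : 'rV[R]_2 => x 0 0) e.
have := congr1 (fun x : 'rV[R]_2 => x 0 1) e; rewrite !point0 !point1 /=.
by move=> /eqP; rewrite eqr_int => /eqP -> /eqP; rewrite eqr_int => /eqP ->.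
Qed.

Lemma pointD u v : pnt (u + v) = pnt u + pnt v.
Proof. by apply: row2P; rewrite [RHS]mxE !(point0, point1) /= intrD. Qed.

Lemma pointN u : pnt (- u) = - pnt u.
Proof. by apply: row2P; rewrite [RHS]mxE !(point0, point1) /= intrN. Qed.

Lemma pointB u v : pnt (u - v) = pnt u - pnt v.
Proof. by rewrite pointD pointN. Qed.

Lemma pointM u (k : nat) : pnt (u *+ k) = k%:R *: pnt u.
Proof.
elim: k => [|k IH]; last by rewrite mulrS pointD IH -natr1 addrC scalerDl scale1r.
by rewrite mulr0n scale0r; apply: row2P; rewrite [RHS]mxE !(point0, point1).
Qed.

Lemma point_eq0 u : (pnt u == 0) = (u == 0).
Proof. by rewrite -(inj_eq point_inj) [in RHS](_ : pnt 0 = 0) // (pointM 0 0) scale0r. Qed.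

Lemma detR_point u v : detR (pnt u) (pnt v) = (det2 u v)%:~R.
Proof. by rewrite /detR !(point0, point1) /det2 intrB !intrM. Qed.

Lemma detRZ (c : R) (u v : 'rV[R]_2) : detR (c *: u) v = c * detR u v.
Proof. by rewrite /detR !mxE; ring. Qed.

Lemma detRZr (c : R) (u v : 'rV[R]_2) : detR u (c *: v) = c * detR u v.
Proof. by rewrite /detR !mxE; ring. Qed.

Lemma detRC (u v : 'rV[R]_2) : detR u v = - detR v u.
Proof. by rewrite /detR; ring. Qed.

Lemma detRuu (u : 'rV[R]_2) : detR u u = 0.
Proof. by rewrite /detR; ring. Qed.

Variable vs : seq pt.
Hypothesis spread : forall v p, v \in vs -> p \in vs -> v != p ->
  exists2 b, b \in vs & area v p b != 0.

Let P : set 'rV[R]_2 := conv [set` map pnt vs].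

(** By [conv_chord] some [v + m * k * u] with [|m| >= 1] lies on a segment from [a] to [b]. If
    [v a b] is a proper triangle, the Cramer coordinates of this point are [t] and [1 - t], which
    gives a reach of at least [k]. *)
Lemma chord_reach u (k : nat) x : u != 0 -> (0 < k)%N ->
  P x -> P (x + k%:R *: pnt u) ->
  exists v a b, [/\ v \in vs, a \in vs, b \in vs & (k <= reach u v a b)%N].
Proof.
move=> u0 k0 hx hy.
have kR0 : k%:R != 0 :> R by rewrite pnatr_eq0 -lt0n.
have w0 : k%:R *: pnt u != 0 by rewrite scaler_eq0 negb_or kR0 point_eq0.
have [? [? [? [t [m [[/mapP[v hv ->] /mapP[a ha ->] /mapP[b hb ->]] /andP[t0 t1] m1 e]]]]]] :=
  conv_chord w0 hx hy erefl.
have {}e : t *: pnt (a - v) + (1 - t) *: pnt (b - v) = (m * k%:R) *: pnt u.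
  rewrite !pointB !scalerBr addrACA e -scalerA -opprD -scalerDl subrKC scale1r.
  by rewrite addrAC subrr add0r.
have mk : (k%:R : R) <= `|m * k%:R| by rewrite normrM normr_nat ler_peMl // ler0n.
set A := a - v in e *; set B := b - v in e *.
have eB : (m * k%:R) * (det2 u B)%:~R = t * (det2 A B)%:~R.
  by rewrite -!detR_point -detRZ -e detRC detR_lin detRuu mulr0 addr0 [detR (pnt B) _]detRC mulrN opprK.
have eA : (m * k%:R) * (det2 A u)%:~R = (1 - t) * (det2 A B)%:~R.
  by rewrite -!detR_point -detRZr -e detR_lin detRuu mulr0 add0r.
have [D0|D0] := eqVneq (area v a b) 0; last first.
  exists v, a, b; split=> //; apply: reach_ge => //.
    rewrite -(ler_int R) intrM -/A -/B.
    have mk2 : 0 < (m * k%:R) ^+ 2.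
      rewrite -real_normK ?num_real // exprn_gt0 //; apply: lt_le_trans mk.
      by rewrite ltr0n.
    rewrite -(pmulr_rge0 _ mk2) expr2 mulrACA eA eB mulrACA.
    by rewrite mulr_ge0 -?expr2 ?sqr_ge0 // mulr_ge0 // subr_ge0.
  rewrite -lez_nat PoszM !abszE -(ler_int R) intrM !intr_norm -/A -/B intrD.
  rewrite /area -/A -/B.
  apply: le_trans (ler_wpM2r (normr_ge0 _) mk) _.
  by rewrite -normrM mulrDr eA eB -mulrDl subrKC mul1r.
(* In a flat triangle [a] and [b] lie on the line through [v] in direction [u], and one of them,
   [c], is at least [k] steps away from [v]. Any vertex [d] off this line then gives a triangle
   [v c d] with sufficient reach. *)
rewrite /area -/A -/B in D0; rewrite D0 !mulr0 in eA eB.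
have mk0 : m * k%:R != 0.
  by rewrite -normr_gt0; apply: lt_le_trans mk; rewrite ltr0n.
have u0' : pnt u != 0 by rewrite point_eq0.
have zB : detR (pnt u) (pnt B) = 0.
  by move/eqP: eB; rewrite mulf_eq0 (negPf mk0) /= => /eqP; rewrite -detR_point.
have zA : detR (pnt u) (pnt A) = 0.
  move/eqP: eA; rewrite mulf_eq0 (negPf mk0) /= => /eqP; rewrite -detR_point detRC.
  by move/eqP; rewrite oppr_eq0 => /eqP.
have [cA eA'] := detR_parallel u0' zA; have [cB eB'] := detR_parallel u0' zB.
suff [c [C [hC ec eC]]] : exists (c : pt) (C : R),
    [/\ c \in vs, pnt (c - v) = C *: pnt u & k%:R <= `|C|].
  have vc : v != c.
    apply: contraTneq eC => vc; move/eqP: ec; rewrite vc subrr eq_sym (pointM 0 0) scale0r scaler_eq0.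
    rewrite (negPf u0') orbF => /eqP ->; rewrite normr0 -ltNge ltr0n //.
  have [d hd D1] := spread hv hC vc.
  have z : det2 (c - v) u = 0.
    by apply/eqP; rewrite -(intr_eq0 R) -detR_point ec detRZ detRuu mulr0.
  exists v, c, d; split=> //; apply: reach_ge => //; first by rewrite z mulr0.
  rewrite z addr0 -lez_nat PoszM !abszE -(ler_int R) intrM !intr_norm.
  rewrite /area -!detR_point ec detRZ normrM.
  exact (ler_wpM2r (normr_ge0 _) eC).
have es : t * cA + (1 - t) * cB = m * k%:R.
  move: e; rewrite eA' eB' !scalerA -scalerDl => /eqP; rewrite -subr_eq0 -scalerBl.
  by rewrite scaler_eq0 (negPf u0') orbF subr_eq0 => /eqP.
have [hA|hA] := leP (k%:R : R) `|cA|; first by exists a, cA.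
have [hB|hB] := leP (k%:R : R) `|cB|; first by exists b, cB.
have : `|m * k%:R| < k%:R :> R.
  have hM : Num.max `|cA| `|cB| < k%:R by rewrite gt_max hA.
  apply: le_lt_trans hM; rewrite -es.
  have : `|cA| <= Num.max `|cA| `|cB| by rewrite le_max lexx.
  have : `|cB| <= Num.max `|cA| `|cB| by rewrite le_max lexx orbT.
  move: (Num.max _ _) => M; rewrite !ler_norml => /andP[b1 b2] /andP[a1 a2].
  have t1' : 0 <= 1 - t by rewrite subr_ge0.
  have := ler_wpM2l t0 a1; have := ler_wpM2l t0 a2.
  have := ler_wpM2l t1' b1; have := ler_wpM2l t1' b2.
  by move=> *; apply/andP; split; lra.
by rewrite ltNge mk.
Qed.

Lemma conv3 v a b (s t : R) : v \in vs -> a \in vs -> b \in vs ->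
  0 <= s -> 0 <= t -> s + t <= 1 ->
  P (pnt v + s *: pnt (a - v) + t *: pnt (b - v)).
Proof.
move=> hv ha hb s0 t0 st.
have inP z : z \in vs -> P (pnt z) by move=> hz; apply: sub_conv; apply/mapP; exists z.
have [z|nz] := eqVneq (s + t) 0.
  have -> : s = 0 by lra.
  have -> : t = 0 by lra.
  by rewrite !scale0r !addr0; apply: inP.
have -> : pnt v + s *: pnt (a - v) + t *: pnt (b - v) =
  (s + t) *: ((s / (s + t)) *: pnt a + (1 - s / (s + t)) *: pnt b) + (1 - (s + t)) *: pnt v.
  by rewrite !pointB; apply/rowP => i; rewrite !mxE; field.
apply: conv_convex; [lra| |exact: inP].
apply: conv_convex; [|exact: inP|exact: inP].
have p0 : 0 < s + t by rewrite lt_def nz addr_ge0.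
by rewrite divr_ge0 ?(ltW p0) //= ler_pdivrMr // mul1r lerDl.
Qed.

(** The coordinates [al] and [be] of [k * u] have equal sign and their sum is at most 1 in absolute
    value; the sign of the sum decides on which side of [v] the triangle lies. *)
Lemma reach_mem u v a b : v \in vs -> a \in vs -> b \in vs ->
  (0 < reach u v a b)%N ->
  P (pnt (v + u *+ reach u v a b)) \/ P (pnt (v - u *+ reach u v a b)).
Proof.
move=> hv ha hb k0; have [D0 s0 _] := reach_gt0 k0.
have := reach_bound u v a b; set k := reach u v a b in k0 *; move=> hk.
have D0R : (area v a b)%:~R != 0 :> R by rewrite intr_eq0.
pose al : R := k%:R * (det2 u (b - v))%:~R / (area v a b)%:~R.
pose be : R := k%:R * (det2 (a - v) u)%:~R / (area v a b)%:~R.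
have eu : k%:R *: pnt u = al *: pnt (a - v) + be *: pnt (b - v).
  have [e1 e2] := det2_cramer (a - v) (b - v) u.
  have [r1 r2] := (congr1 (fun z => z%:~R : R) e1, congr1 (fun z => z%:~R : R) e2).
  rewrite -/(area v a b) [LHS]intrM [RHS]intrD [X in _ = X + _]intrM [X in _ = _ + X]intrM in r1.
  rewrite -/(area v a b) [LHS]intrM [RHS]intrD [X in _ = X + _]intrM [X in _ = _ + X]intrM in r2.
  apply: row2P; rewrite !mxE; apply: (mulfI D0R).
    transitivity (k%:R * ((area v a b)%:~R * u.1%:~R) : R); first by ring.
    by rewrite r1 /al /be /=; field.
  transitivity (k%:R * ((area v a b)%:~R * u.2%:~R) : R); first by rewrite /=; ring.
  by rewrite r2 /al /be /=; field.
have ab : 0 <= al * be.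
  have -> : al * be = (k%:R / (area v a b)%:~R) ^+ 2
      * (det2 u (b - v) * det2 (a - v) u)%:~R :> R.
    by rewrite /al /be intrM; field.
  by rewrite mulr_ge0 ?sqr_ge0 // ler0z.
have sab : `|al + be| <= 1.
  rewrite -mulrDl -mulrDr normrM normfV ler_pdivrMr ?normr_gt0 // mul1r.
  by rewrite normrM normr_nat -intrD -!intr_norm -[k%:R]/((k%:Z)%:~R) -intrM ler_int -!abszE -PoszM lez_nat.
have [p|n] := leP 0 (al + be).
  left; rewrite pointD pointM eu addrA; apply: conv3 => //; [nra|nra|].
  by rewrite ger0_norm in sab.
right; rewrite pointB pointM eu opprD -!scaleNr addrA; apply: conv3 => //; [nra|nra|].
by rewrite ltr0_norm in sab; lra.
Qed.

End LatticePolygon.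

(** * Lattice diameters *)

(** The lattice length of the vector [u]. *)
Definition content (u : pt) : nat := gcdn `|u.1| `|u.2|.

Lemma intMn (x : int) k : x *+ k = x * k%:Z.
Proof. by rewrite -mulr_natr natz. Qed.

Lemma pt_mulrn (u : pt) k : u *+ k = (u.1 *+ k, u.2 *+ k).
Proof. by elim: k => [|k IH] //; rewrite !mulrS IH. Qed.

Lemma contentM u k : content (u *+ k) = (content u * k)%N.
Proof. by rewrite pt_mulrn /content /= !intMn !abszM !absz_nat muln_gcdl. Qed.

Lemma content_gt0 u : (0 < content u)%N = (u != 0).
Proof.
rewrite /content gcdn_gt0 !absz_gt0 -negb_and.
by case: u.
Qed.

Lemma content_div u : exists2 u0, content u0 = 1%N & u = u0 *+ content u.
Proof.
have [->|u0] := eqVneq u 0.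
  (* The zero vector has content 0, and any primitive vector serves for it. *)
  by exists (1, 0); rewrite ?/content // mulr0n.
have g0 : (0 < content u)%N by rewrite content_gt0.
have d1 : (content u %| u.1)%Z by rewrite dvdzE /= dvdn_gcdl.
have d2 : (content u %| u.2)%Z by rewrite dvdzE /= dvdn_gcdr.
have e : u = ((u.1 %/ content u)%Z, (u.2 %/ content u)%Z) *+ content u.
  by rewrite pt_mulrn /= !intMn !divzK //; case: (u).
move: e; set u0' := (_, _) => e; exists u0' => //.
have := congr1 content e; rewrite contentM => /esym/eqP.
by rewrite -{2}[content u]mul1n eqn_pmul2r // => /eqP.
Qed.

Lemma content_bezout u : content u = 1%N ->
  exists p q : int, p * u.1 + q * u.2 = 1.
Proof.
by move=> h; have [p [q e]] := Bezoutz u.1 u.2; exists p, q; rewrite e /gcdz -/(content u) h.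
Qed.

(** The Bezout combination that is 1 on [u] takes on [u'] the value of the proportionality factor,
    which is therefore an integer; comparing contents makes it 1 or -1. *)
Lemma primitive_parallel u u' : content u = 1%N -> content u' = 1%N ->
  det2 u u' = 0 -> u' = u \/ u' = - u.
Proof.
move=> h h' z; have [p [q e]] := content_bezout h.
set t := p * u'.1 + q * u'.2.
have e1 : u'.1 = u.1 * t.
  transitivity (u'.1 * (p * u.1 + q * u.2) + q * det2 u u'); first by rewrite e z; ring.
  by rewrite /t /det2; ring.
have e2 : u'.2 = u.2 * t.
  transitivity (u'.2 * (p * u.1 + q * u.2) - p * det2 u u'); first by rewrite e z; ring.
  by rewrite /t /det2; ring.
have : `|t|%N = 1%N.
  by move: h'; rewrite /content e1 e2 !abszM -muln_gcdl -/(content u) h mul1n.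
move: t e1 e2 => t e1 e2 ht; clear h h' z e.
case: u u' e1 e2 => [a b] [c d] /= -> ->.
have [->|->] : t = 1 \/ t = -1 by lia.
- by left; rewrite !mulr1.
- by right; rewrite !mulrN1.
Qed.

Section LatticeDiameter.
Local Open Scope classical_set_scope.
Local Open Scope ring_scope.

Variable R : realType.
Local Notation pnt := (@point R).

Lemma lattice_point X : lattice (pnt X).
Proof. by move=> i; rewrite mxE rpred_int. Qed.

Lemma latticeP x : lattice x -> exists X, x = pnt X.
Proof.
move=> h; have /intrP[a ea] := h 0; have /intrP[b eb] := h 1.
by exists (a, b); apply: row2P; rewrite !(point0, point1).
Qed.

(** A lattice point of the segment is [X + s * u] with [s] real. The Bezout combination that is 1 on
    [u] shows that [s] is an integer, so the lattice points are the [X + i * u] with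
    [0 <= i <= g]. *)
Lemma seg_points_primitive X u g : content u = 1%N ->
  seg_points (pnt X) (pnt (X + u *+ g)) = g.+1.
Proof.
move=> h; apply: card_fset_set; have [p [q e]] := content_bezout h.
have -> : conv [set pnt X; pnt (X + u *+ g)] `&` @lattice R 2 =
    (fun i : nat => pnt (X + u *+ i)) @` `I_g.+1.
  apply/seteqP; split=> [z [/conv2P[t ht ez] /latticeP[Z eZ]]|_ [i /= hi <-]].
    pose s : R := (1 - t) * g%:R.
    have es : pnt (Z - X) = s *: pnt u.
      by rewrite pointB -eZ ez pointD pointM /s; apply/rowP => k; rewrite !mxE; ring.
    set i : int := p * (Z - X).1 + q * (Z - X).2.
    have si : s = i%:~R.
      have h0 := congr1 (fun x : 'rV[R]_2 => x 0 0) es.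
      have h1 := congr1 (fun x : 'rV[R]_2 => x 0 1) es.
      rewrite [RHS]mxE !point0 in h0; rewrite [RHS]mxE !point1 in h1.
      rewrite /i intrD !intrM h0 h1.
      transitivity (s * (p * u.1 + q * u.2)%:~R); first by rewrite e mulr1.
      by rewrite intrD !intrM; ring.
    have i0 : 0 <= i by rewrite -(ler_int R) -si /s mulr_ge0 //; lra.
    have ig : i <= g%:Z.
      rewrite -(ler_int R) -si /s -[X in _ <= X]mul1r; apply: ler_wpM2r => //.
      by lra.
    have {}si : s = `|i|%N%:R by rewrite si -{1}(gez0_abs i0).
    exists `|i|%N; first by rewrite /= ltnS -lez_nat gez0_abs.
    by rewrite pointD pointM -si -es -pointD addrC subrK.
  split; last exact: lattice_point.
  apply/conv2P; have [g0|g0] := posnP g.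
    exists 1; first by rewrite ler01 lexx.
    have -> : i = 0%N by lia.
    by rewrite g0 mulr0n addr0 -scalerDl subrKC scale1r.
  have gR : (g%:R : R) != 0 by rewrite pnatr_eq0 -lt0n.
  have gR0 : 0 < (g%:R : R) by rewrite ltr0n.
  exists (1 - i%:R / g%:R).
    rewrite subr_ge0 ler_pdivrMr // mul1r ler_nat -ltnS hi /=.
    by rewrite lerBlDr lerDl divr_ge0 // ltW.
  by rewrite !pointD !pointM; apply/rowP => k; rewrite !mxE; field.
apply: inj_card_eq => i j _ _ /point_inj/addrI/eqP.
rewrite !pt_mulrn xpair_eqE !intMn -[_ == u.1 * _]subr_eq0 -[_ == u.2 * _]subr_eq0 -!mulrBr !mulf_eq0.
have : (u.1 != 0) || (u.2 != 0).
  have : (0 < content u)%N by rewrite h.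
  by rewrite content_gt0 -negb_and; case: (u).
by case/orP => /negPf -> /= /andP[h1 h2]; apply/eqP; lia.
Qed.

Lemma seg_points_content X Y :
  seg_points (pnt X) (pnt Y) = (content (Y - X)).+1.
Proof.
have [u hu e] := content_div (Y - X).
by rewrite -{1}(subrKC X Y) {1}e seg_points_primitive.
Qed.

Lemma has_direction_aff2 x y (u : 'rV[R]_2) : x != y ->
  has_direction (aff [set x; y]) u <-> exists2 a : R, a != 0 & u = a *: (y - x).
Proof.
move=> nxy; split=> [[x' [y' [a [nxy' eL a0 ->]]]]|[a a0 ->]]; last by exists x, y, a.
have [s es] : exists s : R, x' = x + s *: (y - x).
  by apply/aff2P; rewrite eL; apply/aff2P; exists 0; rewrite scale0r addr0.
have [s' es'] : exists s : R, y' = x + s *: (y - x).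
  by apply/aff2P; rewrite eL; apply/aff2P; exists 1; rewrite scale1r subrKC.
exists (a * (s' - s)); last first.
  by rewrite es es' opprD addrACA subrr add0r -scalerBl scalerA.
rewrite mulf_neq0 // subr_eq0; apply: contra_neq nxy' => ss.
by rewrite es es' ss.
Qed.


Lemma conv_affine S (w : 'rV[R]_2) (c : R) :
  (forall x, S x -> detR w x = c) -> forall x, aff (conv S) x -> detR w x = c.
Proof.
move=> hS; have hconv x : conv S x -> detR w x = c.
  move: x; apply: conv_ind => // t p x _ /hS hp hx.
  by rewrite detR_lin hp hx -mulrDl subrKC mul1r.
move=> x [n [a [p [a1 hp ->]]]].
have -> : detR w (\sum_i a i *: p i) = \sum_i a i * detR w (p i).
  rewrite /detR !summxE !mulr_sumr -sumrB; apply: eq_bigr => i _.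
  by rewrite !mxE; ring.
by under eq_bigr => i _ do rewrite (hconv _ (hp i)); rewrite -mulr_suml a1 mul1r.
Qed.

Section Polygon.
Variables (P : set 'rV[R]_2) (vs : seq pt).
Hypotheses (hP : lattice_polygon P) (hvs : vertex_list P vs).

Lemma polygon_conv : P = conv [set` map pnt vs].
Proof.
case: hP => hpol _ _; rewrite {1}(polytope_vertices hpol); congr conv.
apply/seteqP; split=> x.
  by move/hvs.2 => [z hz ->]; apply/mapP; exists z.
by move=> /mapP[z hz ->]; apply/hvs.2; exists z.
Qed.

(** Here full dimension enters: if [detR w] were constant on the vertices, it would be constant on
    [aff P], the whole plane. *)
Lemma vs_not_aligned (w : 'rV[R]_2) c : w != 0 -> exists2 p, p \in vs & detR w (pnt p) != c.
Proof.
move=> w0; apply: contrapT => h.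
have hS x : [set` map pnt vs] x -> detR w x = c.
  by move=> /mapP[p hp ->]; apply: contrapT => /eqP ne; apply: h; exists p.
have hA x : detR w x = c.
  by apply: (conv_affine hS); rewrite -polygon_conv; case: hP => _ -> _.
have c0 : c = 0 by rewrite -(hA 0) /detR !mxE; ring.
case/eqP: w0; apply: row2P; rewrite mxE.
  by have := hA (pnt (0, 1)); rewrite /detR point0 point1 c0 /=; lra.
by have := hA (pnt (1, 0)); rewrite /detR point0 point1 c0 /=; lra.
Qed.

Lemma polygon_spread v p : v \in vs -> p \in vs -> v != p ->
  exists2 b, b \in vs & area v p b != 0.
Proof.
move=> hv hp nvp.
have w0 : pnt (p - v) != 0 by rewrite point_eq0 subr_eq0 eq_sym.
have [b hb hd] := vs_not_aligned (detR (pnt (p - v)) (pnt v)) w0.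
exists b => //; rewrite -(intr_eq0 R) -detR_point; apply: contra_neq hd.
by rewrite /detR !(point0, point1) /= !(intrD, intrN) => h; lra.
Qed.

Lemma polygon_triangle : exists v a b,
  [/\ v \in vs, a \in vs, b \in vs & area v a b != 0].
Proof.
have e0 : pnt (1, 0) != 0 by rewrite point_eq0.
have e1 : pnt (0, 1) != 0 by rewrite point_eq0.
have [v hv _] := vs_not_aligned 0 e0.
have [a ha na] : exists2 a, a \in vs & v != a.
  apply: contrapT => h; have al a : a \in vs -> a = v.
    by move=> ha; apply: contrapT => /eqP ne; apply: h; exists a; rewrite // eq_sym.
  have [b hb] := vs_not_aligned (detR (pnt (1, 0)) (pnt v)) e0.
  by rewrite (al b hb) eqxx.
by have [b hb D0] := polygon_spread hv ha na; exists v, a, b.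
Qed.

Variable best : nat.
Hypothesis best_gt0 : (0 < best)%N.
Hypothesis best_max : forall u p q r, p \in vs -> q \in vs -> r \in vs ->
  (reach u p q r <= best)%N.

Lemma content_chord X Y : P (pnt X) -> P (pnt Y) ->
  (content (Y - X)%R <= best)%N.
Proof.
move=> hX hY; have [->//|g0] := posnP (content (Y - X)).
have [u hu e] := content_div (Y - X).
have u0 : u != 0 by rewrite -content_gt0 hu.
have [||v [a [b [hv ha hb h]]]] := @chord_reach R vs polygon_spread u _ (pnt X) u0 g0.
- by rewrite -polygon_conv.
- by rewrite -polygon_conv -pointM -e -pointD subrKC.
exact: leq_trans h (best_max _ hv ha hb).
Qed.

(** The [best] steps end in [P] on one of the two sides of [v], hence the sign of [s], and
    [content_chord] excludes longer segments. The same bound makes [u] primitive, because this chord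
    has content [content u * best]. *)
Lemma reach_diameter u v a b : v \in vs -> a \in vs -> b \in vs ->
  reach u v a b = best ->
  content u = 1%N /\
  exists s : int, [/\ s != 0, diameter_pair P (pnt v) (pnt (v + u *~ s))
    & seg_points (pnt v) (pnt (v + u *~ s)) = best.+1].
Proof.
move=> hv ha hb hbest.
have hPv : P (pnt v) by rewrite polygon_conv; apply: sub_conv; apply/mapP; exists v.
have k0 : (0 < reach u v a b)%N by rewrite hbest.
have [s [hs hPs]] : exists s : int, (s = best%:Z \/ s = - best%:Z) /\ P (pnt (v + u *~ s)).
  have := reach_mem R hv ha hb k0; rewrite -polygon_conv hbest.
  by case=> h; [exists best%:Z|exists (- best%:Z)]; split; rewrite ?mulrNz //; tauto.
have cs : content (u *~ s) = (content u * best)%N.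
  by case: hs => ->; rewrite ?mulrNz -?pmulrn /content /= ?abszN -/(content _) contentM.
have hc := content_chord hPv hPs; rewrite addrC addKr cs in hc.
have u0 : (0 < content u)%N.
  by have [_ _] := reach_gt0 k0; rewrite content_gt0; apply: contra_neq => ->; rewrite /det2 /= !mulr0 !mul0r !subr0.
have c1 : content u = 1%N by nia.
split=> //; exists s.
have s0 : s != 0 by case: hs => ->; rewrite ?oppr_eq0; lia.
have ec : content (v + u *~ s - v) = best by rewrite addrC addKr cs c1 mul1n.
rewrite seg_points_content ec; split=> //.
split; [by split=> //; exact: lattice_point|by split=> //; exact: lattice_point|].
move=> x' y' [hx' /latticeP[X ex]] [hy' /latticeP[Y ey]].
rewrite ex ey in hx' hy' *; rewrite !seg_points_content ec ltnS.
exact: content_chord.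
Qed.

Lemma best_diameter u v a b : v \in vs -> a \in vs -> b \in vs ->
  reach u v a b = best -> is_lattice_diameter P best.
Proof.
move=> hv ha hb hbest; have [_ [s [_ dp es]]] := reach_diameter hv ha hb hbest.
by exists (pnt v), (pnt (v + u *~ s)); rewrite es.
Qed.

Lemma aff_line v u (s : int) : s != 0 ->
  aff [set pnt v; pnt (v + u *~ s)] = @line_of R (v, v + u).
Proof.
move=> s0; have sR : (s%:~R : R) != 0 by rewrite intr_eq0.
have es : pnt (v + u *~ s) - pnt v = s%:~R *: (pnt (v + u) - pnt v).
  rewrite -!pointB ![v + _ - v]addrAC subrr !add0r scaler_int.
  by case: s {s0 sR} => n; rewrite ?NegzE ?mulrNz ?pointN -!pmulrn pointM scaler_nat.
apply/seteqP; split=> x /aff2P[t ->]; apply/aff2P.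
  by exists (t * s%:~R); rewrite es scalerA.
by exists (t / s%:~R); rewrite es scalerA divfK.
Qed.

Lemma line_direction v u (w : 'rV[R]_2) : u != 0 ->
  has_direction (@line_of R (v, v + u)) w <-> exists2 a : R, a != 0 & w = a *: pnt u.
Proof.
move=> u0; have -> : pnt u = pnt (v + u) - pnt v by rewrite -pointB addrC addKr.
apply: has_direction_aff2; rewrite (inj_eq (@point_inj R)).
by rewrite -[X in X == _]addr0 (inj_eq (addrI v)) eq_sym.
Qed.

(** * From the hits of a search to one line in each diameter direction *)

Section Lines.
Variables (dir : nat -> pt) (rng : pred nat).
Hypothesis dir_all : forall u p q r, p \in vs -> q \in vs -> r \in vs ->
  reach u p q r = best -> exists2 c, rng c & u = dir c \/ - u = dir c.
Hypothesis dir_inj : forall c c', rng c -> rng c' ->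
  dir c = dir c' \/ dir c = - dir c' -> c = c'.
Hypothesis attained : exists u p q r,
  [/\ p \in vs, q \in vs, r \in vs & reach u p q r = best].
Variable hs : seq (nat * pt).
Hypothesis hs_uniq : uniq (unzip1 hs).
Hypothesis hs_sound : forall c v, (c, v) \in hs ->
  [/\ rng c, v \in vs & exists a b, [/\ a \in vs, b \in vs & reach (dir c) v a b = best]].
Hypothesis hs_complete : forall c p q r, rng c ->
  p \in vs -> q \in vs -> r \in vs -> reach (dir c) p q r = best ->
  c \in unzip1 hs.

Lemma hs_key c v v' : (c, v) \in hs -> (c, v') \in hs -> v = v'.
Proof.
move: hs_uniq; elim: (hs) => // -[d w] s IH /= /andP[ns us].
rewrite !inE !xpair_eqE => /orP[/andP[/eqP-> /eqP->]|h] /orP[/andP[/eqP e /eqP->]|h'] //.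
- by move: ns; rewrite (map_f fst h').
- by move: ns; rewrite -e (map_f fst h).
- exact: IH.
Qed.

Lemma hs_content c v : (c, v) \in hs -> content (dir c) = 1%N.
Proof.
move=> /hs_sound[_ hv [a [b [ha hb /(reach_diameter hv ha hb)[]]]]] //.
Qed.

(** A diameter segment in direction [w] can be slid to a triple whose reach is [best], so its
    primitive direction is some [dir c] up to sign, and [c] has a hit. For uniqueness, two hits in
    direction [w] have parallel primitive vectors; these agree up to sign, so the indices agree, and
    every index occurs only once. *)
Lemma diameter_lines_of_hits : diameter_lines_of P [seq (h.2, h.2 + dir h.1) | h <- hs].
Proof.
have dir0 c v : (c, v) \in hs -> dir c != 0.
  by move=> /hs_content h; rewrite -content_gt0 h.
split.
- rewrite map_inj_in_uniq ?(map_uniq hs_uniq) // => -[c v] [c' v'] h h' eq.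
  have /= ev := congr1 fst eq; have /= /eqP := congr1 snd eq.
  rewrite ev (inj_eq (addrI _)) => /eqP e.
  have [[rc _ _] [rc' _ _]] := (hs_sound h, hs_sound h').
  by rewrite (dir_inj rc rc' (or_introl e)).
- move=> _ /mapP[[c v] h ->] /=; split.
    by rewrite -[X in X != _]addr0 (inj_eq (addrI v)) eq_sym (dir0 _ _ h).
  have [_ hv [a [b [ha hb hbest]]]] := hs_sound h.
  have [_ [s [s0 dp _]]] := reach_diameter hv ha hb hbest.
  by exists (pnt v), (pnt (v + dir c *~ s)); rewrite aff_line.
move=> w [L [[x [y [[[hPx /latticeP[X ex]] [hPy /latticeP[Y ey]] dmax] eL]] hL]]].
rewrite ex ey in hPx hPy eL dmax.
have eg : content (Y - X) = best.
  apply/eqP; rewrite eqn_leq content_chord //=.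
  have [u [p [q [r [hp hq hr hbest]]]]] := attained.
  have [_ [s [_ [h1 h2 _] es]]] := reach_diameter hp hq hr hbest.
  by have := dmax _ _ h1 h2; rewrite es seg_points_content.
have [u hu e] := content_div (Y - X); rewrite eg in e.
have u0 : u != 0 by rewrite -content_gt0 hu.
have nXY : pnt X != pnt Y.
  by rewrite (inj_eq (@point_inj R)) eq_sym -subr_eq0 -content_gt0 eg.
move: hL; rewrite eL => /(has_direction_aff2 _ nXY)[al al0 ew].
have {}ew : w = (al * best%:R) *: pnt u by rewrite ew -pointB e pointM scalerA.
have be0 : al * best%:R != 0 by rewrite mulf_neq0 // pnatr_eq0 -lt0n.
have [||v [a [b [hv ha hb hk]]]] := @chord_reach R vs polygon_spread u best (pnt X) u0 best_gt0.
- by rewrite -polygon_conv.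
- by rewrite -polygon_conv -pointM -e -pointD subrKC.
have {}hk : reach u v a b = best by apply/eqP; rewrite eqn_leq hk best_max.
have [c rc uc] := dir_all hv ha hb hk.
have {}hk : reach (dir c) v a b = best by case: uc => <-; rewrite ?reachN.
have /mapP[[c1 v1] hcv /= ec] := hs_complete rc hv ha hb hk; rewrite -{}ec in hcv.
have [be {}be0 {}ew] : exists2 be : R, be != 0 & w = be *: pnt (dir c).
  case: uc => <-; first by exists (al * best%:R).
  by exists (- (al * best%:R)); rewrite ?oppr_eq0 // pointN scaleNr scalerN opprK.
exists (v1, v1 + dir c); split.
  split; first by apply/mapP; exists (c, v1).
  by apply/line_direction; [exact: dir0 hcv|exists be].
move=> _ [/mapP[[c' v'] h' ->] /= /(line_direction _ _ (dir0 _ _ h'))[ga ga0 ew']].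
have cc : c = c'.
  apply: dir_inj => //; first by case: (hs_sound h').
  apply: (primitive_parallel (hs_content h') (hs_content hcv)).
  apply/eqP; rewrite -(intr_eq0 R) -detR_point; apply/eqP; apply: (mulfI ga0).
  by rewrite -detRZ -ew' ew detRZ detRuu !mulr0.
by rewrite -cc in h' *; rewrite (hs_key hcv h').
Qed.
End Lines.

End Polygon.
End LatticeDiameter.

(** * The program *)

(** Registers live at negative addresses, [Negz k] being [- (k + 1)], which leaves the nonnegative
    ones to the input and the output. *)
Definition reg (k : nat) : expr := Read (Const (Negz k)).
Definition set_reg (k : nat) (e : expr) : cmd := Write (Const (Negz k)) e.

Definition eMod (a b : expr) := Op Sub a (Op Mul b (Op Div a b)).
Definition eAbs (a : expr) :=
  Op Mul a (Op Sub (Const 1) (Op Mul (Const 2) (Op Lt a (Const 0)))).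
Definition eDet (a1 a2 b1 b2 : expr) := Op Sub (Op Mul a1 b2) (Op Mul a2 b1).

Notation rN := 0%N (only parsing).
Notation rN3 := 1%N (only parsing).
Notation rI := 2%N (only parsing).
Notation rD := 3%N (only parsing).
Notation rAx := 4%N (only parsing).
Notation rAy := 5%N (only parsing).
Notation rBx := 6%N (only parsing).
Notation rBy := 7%N (only parsing).
Notation rT := 8%N (only parsing).
Notation rb1x := 9%N (only parsing).
Notation rb1y := 10%N (only parsing).
Notation rb2x := 11%N (only parsing).
Notation rb2y := 12%N (only parsing).
Notation rtx := 13%N (only parsing).
Notation rty := 14%N (only parsing).
Notation rBest := 15%N (only parsing).
Notation rLast := 16%N (only parsing).
Notation rCnt := 17%N (only parsing).
Notation rUx := 18%N (only parsing).
Notation rUy := 19%N (only parsing).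

(* The coordinates of the [i]-th vertex are copied to the addresses
   [-100 - 2 i] and [-101 - 2 i], so that the output can overwrite the input. *)
Definition eX (i : expr) := Read (Op Sub (Const (-100)) (Op Mul (Const 2) i)).
Definition eY (i : expr) := Read (Op Sub (Const (-101)) (Op Mul (Const 2) i)).

(* A triple of vertices is encoded by a number below [n ^ 3]. *)
Definition eV (t : expr) := eMod t (reg rN).
Definition eA (t : expr) := eMod (Op Div t (reg rN)) (reg rN).
Definition eB (t : expr) := Op Div (Op Div t (reg rN)) (reg rN).

Definition eAx (t : expr) := Op Sub (eX (eA t)) (eX (eV t)).
Definition eAy (t : expr) := Op Sub (eY (eA t)) (eY (eV t)).
Definition eBx (t : expr) := Op Sub (eX (eB t)) (eX (eV t)).
Definition eBy (t : expr) := Op Sub (eY (eB t)) (eY (eV t)).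
Definition eArea (t : expr) := eDet (eAx t) (eAy t) (eBx t) (eBy t).

Definition eReach (u1 u2 t : expr) :=
  let p := eDet u1 u2 (eBx t) (eBy t) in
  let q := eDet (eAx t) (eAy t) u1 u2 in
  Op Mul (Op Sub (Const 1) (Op Lt (Op Mul p q) (Const 0)))
    (Op Div (eAbs (eArea t)) (eAbs (Op Add p q))).

Definition eDotAB (u1 u2 w1 w2 : expr) :=
  Op Add (Op Mul (eDet u1 u2 (reg rBx) (reg rBy)) (eDet w1 w2 (reg rBx) (reg rBy)))
         (Op Mul (eDet (reg rAx) (reg rAy) u1 u2) (eDet (reg rAx) (reg rAy) w1 w2)).

(* The integer nearest to [qdot b1 b2 / qform b1]. *)
Definition eRound :=
  let q := eDotAB (reg rb1x) (reg rb1y) (reg rb1x) (reg rb1y) in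
  let s := eDotAB (reg rb1x) (reg rb1y) (reg rb2x) (reg rb2y) in
  Op Div (Op Add (Op Mul (Const 2) s) q) (Op Mul (Const 2) q).

(** A single counter runs over all pairs of a candidate index and a triple, the index varying
    slowest; there are [480 = 496 - 16] indices. *)
Definition eC := Op Add (Const 16) (Op Div (reg rI) (reg rN3)).
Definition eTri := eMod (reg rI) (reg rN3).
(** The arguments are the registers of one coordinate of the two basis vectors. The second vector is
    taken from [rtx] and [rty], since the Gauss loop ends with a reduced pair formed by [b1] and the
    size-reduced [b2]. *)
Definition eU (b t : nat) :=
  Op Add (Op Mul (Op Sub (eMod eC (Const 31)) (Const 15)) (reg b))
         (Op Mul (Op Div eC (Const 31)) (reg t)).
Definition eR := eReach (reg rUx) (reg rUy) eTri.

Definition incr k := set_reg k (Op Add (reg k) (Const 1)).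

Definition copy_body :=
  Seq (Write (Op Sub (Const (-100)) (reg rI)) (Read (Op Add (Const 1) (reg rI)))) (incr rI).
Definition copy_guard := Op Lt (reg rI) (Read (Const 0)).
Definition copy_loop := While copy_guard copy_body.

Definition area_body :=
  Seq (If (Op Lt (reg rD) (eAbs (eArea (reg rI))))
          (Seq (set_reg rD (eAbs (eArea (reg rI)))) (set_reg rT (reg rI)))
          Skip)
      (incr rI).
Definition area_guard := Op Lt (reg rI) (reg rN3).
Definition area_loop := While area_guard area_body.

Definition set_diff :=
  Seq (set_reg rtx (Op Sub (reg rb2x) (Op Mul eRound (reg rb1x))))
      (set_reg rty (Op Sub (reg rb2y) (Op Mul eRound (reg rb1y)))).
Definition gauss_body :=
  Seq (Seq (Seq (set_reg rb2x (reg rb1x)) (set_reg rb2y (reg rb1y)))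
           (Seq (set_reg rb1x (reg rtx)) (set_reg rb1y (reg rty))))
      set_diff.
(** A further round is made only if it more than halves [qform b1], not whenever it decreases it.
    This bounds the number of rounds by a bit length and costs only the factor 2 in the length
    condition of [reduced_coef]. *)
Definition gauss_guard :=
  Op Lt (Op Mul (Const 2) (eDotAB (reg rtx) (reg rty) (reg rtx) (reg rty)))
        (eDotAB (reg rb1x) (reg rb1y) (reg rb1x) (reg rb1y)).
Definition gauss_loop := While gauss_guard gauss_body.

Definition set_u := Seq (set_reg rUx (eU rb1x rtx)) (set_reg rUy (eU rb1y rty)).
Definition best_body :=
  Seq (Seq set_u (If (Op Lt (reg rBest) eR) (set_reg rBest eR) Skip)) (incr rI).
Definition cand_guard := Op Lt (reg rI) (Op Mul (Const 480) (reg rN3)).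
Definition best_loop := While cand_guard best_body.

Definition out_addr k := Op Add (Op Mul (Const 4) (reg rCnt)) (Const k).
(** The point [v + u] only serves to span the line: it may lie outside the polygon when the chord
    leaves [v] along [- u]. *)
Definition emit :=
  Seq (Seq (Seq (Write (out_addr 1) (eX (eV eTri))) (Write (out_addr 2) (eY (eV eTri))))
           (Seq (Write (out_addr 3) (Op Add (eX (eV eTri)) (reg rUx)))
                (Write (out_addr 4) (Op Add (eY (eV eTri)) (reg rUy)))))
      (Seq (set_reg rLast eC) (incr rCnt)).
(** Differences serve as tests, a nonzero value selecting the first branch. As the candidate index
    never decreases, comparing it with the last one output is enough to output each direction once;
    [rLast] starts at 0, below all indices. *)
Definition emit_body :=
  Seq (Seq set_u (If (Op Sub eR (reg rBest)) Skip
                     (If (Op Sub eC (reg rLast)) emit Skip))) (incr rI).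
Definition emit_loop := While cand_guard emit_body.

Definition prologue :=
  Seq (set_reg rN (Op Div (Read (Const 0)) (Const 2))) (set_reg rI (Const 0)).
Definition area_init :=
  Seq (Seq (set_reg rN3 (Op Mul (Op Mul (reg rN) (reg rN)) (reg rN))) (set_reg rI (Const 0)))
      (Seq (set_reg rD (Const 0)) (set_reg rT (Const 0))).
Definition gauss_init :=
  Seq (Seq (Seq (set_reg rAx (eAx (reg rT))) (set_reg rAy (eAy (reg rT))))
           (Seq (set_reg rBx (eBx (reg rT))) (set_reg rBy (eBy (reg rT)))))
  (Seq (Seq (Seq (set_reg rb1x (Const 1)) (set_reg rb1y (Const 0)))
            (Seq (set_reg rb2x (Const 0)) (set_reg rb2y (Const 1))))
       set_diff).
Definition best_init := Seq (set_reg rBest (Const 0)) (set_reg rI (Const 0)).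
Definition find_best :=
  Seq (Seq (Seq prologue copy_loop) (Seq area_init area_loop))
      (Seq (Seq gauss_init gauss_loop) (Seq best_init best_loop)).
Definition emit_init :=
  Seq (Seq (set_reg rLast (Const 0)) (set_reg rCnt (Const 0))) (set_reg rI (Const 0)).
Definition lines_prog :=
  Seq find_best
    (Seq (Seq emit_init emit_loop) (Write (Const 0) (Op Mul (Const 4) (reg rCnt)))).
Definition diameter_prog :=
  Seq find_best (Seq (Write (Const 1) (reg rBest)) (Write (Const 0) (Const 1))).


Section Eval.
Variable m : memory.

Lemma eval_mod a b x y : eval m a = Posz x -> eval m b = Posz y ->
  eval m (eMod a b) = Posz (x %% y)%N.
Proof.
move=> ea eb; rewrite /eMod /= ea eb divz_nat {1}(divn_eq x y); lia.
Qed.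

Lemma eval_div a b x y : eval m a = Posz x -> eval m b = Posz y ->
  eval m (Op Div a b) = Posz (x %/ y)%N.
Proof. by move=> /= -> ->; rewrite divz_nat. Qed.

Lemma eval_abs a : eval m (eAbs a) = `|eval m a|%N.
Proof. by rewrite /eAbs /=; case: (ltrP (eval m a) 0) => h /=; lia. Qed.

Lemma eval_det a1 a2 b1 b2 : eval m (eDet a1 a2 b1 b2) =
  det2 (eval m a1, eval m a2) (eval m b1, eval m b2).
Proof. by []. Qed.

End Eval.

Section Spec.
Variable vs : seq pt.
Let n := size vs.
Definition vtx i : pt := nth 0 vs i.

Definition triple_v t := vtx (t %% n)%N.
Definition triple_a t := vtx (t %/ n %% n)%N.
Definition triple_b t := vtx (t %/ n %/ n)%N.

Definition base (m : memory) :=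
  [/\ m (Negz rN) = n, m (Negz rN3) = (n ^ 3)%N
    & forall i, (i < n)%N -> m (Negz (99 + 2 * i)) = (vtx i).1
                          /\ m (Negz (100 + 2 * i)) = (vtx i).2].

(** The cells [Negz 0] and [Negz 1] hold [n] and [n ^ 3], and the vertices are stored from [Negz 99]
    on; all other addresses may be overwritten without harm to [base]. *)
Definition scratch (a : int) :=
  match a with Posz _ => true | Negz k => (1 < k < 99)%N end.

Lemma base_upd m a z : scratch a -> base m -> base (upd m a z).
Proof.
move=> ha [h0 h1 h2].
have ne k : (k <= 1)%N || (99 <= k)%N -> upd m a z (Negz k) = m (Negz k).
  by rewrite /upd; case: eqP ha => // <- /=; lia.
by split=> [||i /h2[e1 e2]]; rewrite !ne //; lia.
Qed.

Lemma base_size_gt0 t : (t < n ^ 3)%N -> (0 < n)%N.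
Proof. by case: n. Qed.

Section EvalBase.
Variables (m : memory) (e : expr) (t : nat).
Hypotheses (hm : base m) (he : eval m e = t) (ht : (t < n ^ 3)%N).

Let n0 := base_size_gt0 ht.

Lemma eval_vtx f i : (i < n)%N -> eval m f = Posz i ->
  (eval m (eX f), eval m (eY f)) = vtx i.
Proof.
case: hm => _ _ h hi ef; rewrite /eX /eY /= ef.
rewrite (_ : (-100 - 2 * i%:Z) = Negz (99 + 2 * i)); last by lia.
rewrite (_ : (-101 - 2 * i%:Z) = Negz (100 + 2 * i)); last by lia.
by have [-> ->] := h _ hi; case: (vtx i).
Qed.

Lemma eval_reg_n : eval m (reg rN) = n. Proof. by case: hm. Qed.

Lemma eval_v : (eval m (eX (eV e)), eval m (eY (eV e))) = triple_v t.
Proof. by apply: eval_vtx; [rewrite ltn_mod|apply: eval_mod he eval_reg_n]. Qed.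

Lemma eval_a : (eval m (eX (eA e)), eval m (eY (eA e))) = triple_a t.
Proof.
apply: eval_vtx; first by rewrite ltn_mod.
by apply: eval_mod eval_reg_n; apply: eval_div he eval_reg_n.
Qed.

Lemma eval_b : (eval m (eX (eB e)), eval m (eY (eB e))) = triple_b t.
Proof.
apply: eval_vtx.
  by rewrite !ltn_divLR //; move: ht; rewrite !expnS expn0 muln1 mulnA.
by apply: eval_div eval_reg_n; apply: eval_div he eval_reg_n.
Qed.

Lemma eval_AB : (eval m (eAx e), eval m (eAy e)) = triple_a t - triple_v t /\
  (eval m (eBx e), eval m (eBy e)) = triple_b t - triple_v t.
Proof. by rewrite -eval_v -eval_a -eval_b. Qed.

Lemma eval_area : eval m (eArea e) = area (triple_v t) (triple_a t) (triple_b t).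
Proof. by have [eA' eB'] := eval_AB; rewrite /eArea eval_det eA' eB'. Qed.

Lemma eval_reach u1 u2 : eval m (eReach u1 u2 e) =
  reach (eval m u1, eval m u2) (triple_v t) (triple_a t) (triple_b t).
Proof.
rewrite /eReach; set p := eDet u1 u2 _ _; set q := eDet _ _ u1 u2.
have [eA' eB'] := eval_AB.
have ep : eval m p = det2 (eval m u1, eval m u2) (triple_b t - triple_v t).
  by rewrite eval_det eB'.
have eq : eval m q = det2 (triple_a t - triple_v t) (eval m u1, eval m u2).
  by rewrite eval_det eA'.
transitivity ((1 - (nat_of_bool (eval m p * eval m q < 0))%:Z) *
  (eval m (eAbs (eArea e)) %/ eval m (eAbs (Op Add p q)))%Z); first by [].
rewrite !eval_abs eval_area -[eval m (Op Add p q)]/(eval m p + eval m q) ep eq.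
rewrite /reach divz_nat.
by case: ifP => _; rewrite /= ?subrr ?mul0r ?subr0 ?mul1r.
Qed.

End EvalBase.
End Spec.

(** * Execution *)

Lemma upd_reg m k z k' :
  upd m (Negz k) z (Negz k') = if k' == k then z else m (Negz k').
Proof. by []. Qed.

Lemma upd_reg_pos m k z k' : upd m (Negz k) z (Posz k') = m (Posz k').
Proof. by []. Qed.

Lemma size_encode_points vs : size (encode_points vs) = (2 * size vs)%N.
Proof. by elim: vs => //= v vs; rewrite /encode_points /= => ->; lia. Qed.

Lemma nth_encode_points vs i : (i < size vs)%N ->
  (encode_points vs)`_(2 * i) = (vtx vs i).1 /\
  (encode_points vs)`_(2 * i).+1 = (vtx vs i).2.
Proof.
elim: vs i => // v vs IH [|i]; first by [].
by rewrite ltnS => /IH; rewrite mulnS.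
Qed.

Lemma size_encode_lines ls : size (encode_lines ls) = (4 * size ls)%N.
Proof. by elim: ls => //= l ls; rewrite /encode_lines /= => ->; lia. Qed.

Lemma encode_lines_rcons ls l : encode_lines (rcons ls l) =
  encode_lines ls ++ [:: l.1.1; l.1.2; l.2.1; l.2.2].
Proof. by rewrite /encode_lines map_rcons flatten_rcons. Qed.

(** * The size reduction step of Gauss *)

Section Reduction.
Variables (A B : pt).

Definition nearest (b1 b2 : pt) : int :=
  ((2 * qdot A B b1 b2 + qform A B b1) %/ (2 * qform A B b1))%Z.

Definition size_reduce (b1 b2 : pt) : pt :=
  (b2.1 - nearest b1 b2 * b1.1, b2.2 - nearest b1 b2 * b1.2).

Lemma size_reduceE b1 b2 : size_reduce b1 b2 = lin (- nearest b1 b2) 1 b1 b2.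
Proof. by rewrite /size_reduce /lin; congr pair; ring. Qed.

Lemma det2_size_reduce b1 b2 : det2 b1 (size_reduce b1 b2) = det2 b1 b2.
Proof. by rewrite /size_reduce /det2 /=; ring. Qed.

Lemma qdot_size_reduce b1 b2 :
  qdot A B b1 (size_reduce b1 b2) = qdot A B b1 b2 - nearest b1 b2 * qform A B b1.
Proof. by rewrite /size_reduce /qform /qdot /det2 /=; ring. Qed.

(** With [q = qform b1], the remainder of the division in [nearest] lies in [[0, 2q)] and equals
    twice the new product plus [q]. *)
Lemma qdot_size_reduce_le b1 b2 : 0 < qform A B b1 ->
  2 * `|qdot A B b1 (size_reduce b1 b2)| <= qform A B b1.
Proof.
move=> q0; rewrite qdot_size_reduce /nearest.
have q2 : 2 * qform A B b1 != 0 by lia.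
have := divz_eq (2 * qdot A B b1 b2 + qform A B b1) (2 * qform A B b1).
have := modz_ge0 (2 * qdot A B b1 b2 + qform A B b1) q2.
have := ltz_pmod (2 * qdot A B b1 b2 + qform A B b1) (_ : 0 < 2 * qform A B b1).
move: (_ %/ _)%Z (_ %% _)%Z => r d.
have -> : r * (2 * qform A B b1) = 2 * (r * qform A B b1) by ring.
move: (qdot A B b1 b2) (r * qform A B b1) => s w; lia.
Qed.

(** With [s'] the new product, the norm drops by [r * (2 s' + r p)]. For an integer [r != 0] one has
    [|2 s'| <= p <= |r p|], so the bracket has the sign of [r] or vanishes. *)
Lemma qform_size_reduce_le b1 b2 : 0 < qform A B b1 ->
  qform A B (size_reduce b1 b2) <= qform A B b2.
Proof.
move=> q0; have := qdot_size_reduce_le b2 q0; rewrite qdot_size_reduce.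
rewrite size_reduceE qform_lin; move: (nearest b1 b2) (qdot A B b1 b2) (qform A B b1) (qform A B b2) q0.
move=> r s p q p0 h.
have -> : (- r) ^+ 2 * p + 2 * - r * 1 * s + 1 ^+ 2 * q = q - r * (2 * (s - r * p) + r * p).
  by ring.
rewrite lerBlDr lerDl; have [->|[r0|r0]] : r = 0 \/ 1 <= r \/ r <= -1 by lia.
- by rewrite mul0r.
- have hp : p <= r * p by rewrite ler_peMl // ltW.
  by apply: mulr_ge0; [lia|move: (r * p) hp h => w; lia].
- have hp : p <= - (r * p) by rewrite -mulNr; apply: ler_peMl; [exact: ltW|lia].
  by apply: mulr_le0; [lia|move: (r * p) hp h => w; lia].
Qed.

(** A small [qform] bounds both determinants of [u], since [|z| <= z ^ 2] for integers, and Cramer's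
    rule with a determinant of absolute value at least 1 bounds the coordinates. This keeps the
    numbers short during the reduction. *)
Lemma qform_coord_le c u : det2 A B != 0 ->
  (`|A.1| <= 2 * c)%N -> (`|A.2| <= 2 * c)%N ->
  (`|B.1| <= 2 * c)%N -> (`|B.2| <= 2 * c)%N ->
  qform A B u <= (8 * c ^ 2)%N ->
  (`|u.1| <= 16 * c ^ 3)%N /\ (`|u.2| <= 16 * c ^ 3)%N.
Proof.
move=> D0 a1 a2 b1 b2 hq; have [e1 e2] := det2_cramer A B u.
have D1 : (0 < `|det2 A B|)%N by rewrite absz_gt0.
have hs : (`|det2 u B| + `|det2 A u| <= 8 * c ^ 2)%N.
  move: hq; rewrite /qform /qdot; move: (8 * c ^ 2)%N (det2 u B) (det2 A u) => k x y.
  clear; have h (z : int) : (`|z| <= `|(z * z)%R|)%N by rewrite abszM; case: `|z|%N => // j; rewrite leq_pmulr.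
  by have := h x; have := h y; lia.
have gen x p q : det2 A B * x = det2 u B * p + det2 A u * q ->
    (`|p| <= 2 * c)%N -> (`|q| <= 2 * c)%N -> (`|x| <= 16 * c ^ 3)%N.
  move=> e hp hq'; apply: (@leq_trans (`|det2 A B| * `|x|)%N); first exact: leq_pmull.
  rewrite -abszM e; apply: leq_trans (absz_addle _ _) _; rewrite !abszM.
  apply: (@leq_trans ((`|det2 u B| + `|det2 A u|) * (2 * c))%N).
    by rewrite mulnDl leq_add // leq_mul2l ?hp ?hq' orbT.
  apply: (@leq_trans (8 * c ^ 2 * (2 * c))%N); first by rewrite leq_mul2r hs orbT.
  by rewrite (expnS c 2); lia.
by split; [apply: (gen _ A.1 B.1)|apply: (gen _ A.2 B.2)].
Qed.

End Reduction.

Section Run.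
Variables (vs : seq pt) (c L : nat).
Let n := size vs.
(** A uniform bound on every integer stored by the program. The constant 2000 covers the possible
    output length [4 * 480 * n ^ 3] and the output coordinates, at most [481 * c ^ 3]. Intermediate
    values of an expression may be larger; [esize] accounts for them. *)
Let big := (2000 * n ^ 3 * c ^ 3)%N.
Hypotheses (n_gt0 : (0 < n)%N) (c_gt0 : (0 < c)%N) (big_L : (big < 2 ^ L)%N).
Hypothesis vs_c : forall v, v \in vs -> (`|v.1| <= c)%N /\ (`|v.2| <= c)%N.

Lemma L_gt0 : (0 < L)%N.
Proof.
have b0 : (0 < big)%N by rewrite /big 2!muln_gt0 2!expn_gt0 n_gt0 c_gt0.
by case: L big_L => //; rewrite expn0 ltnS leqNgt b0.
Qed.

Lemma vtx_mem i : (i < n)%N -> vtx vs i \in vs.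
Proof. exact: mem_nth. Qed.

Lemma fits z : (`|z| <= big)%N -> (bitlen z <= L)%N.
Proof. by move=> h; apply: bitlen_le L_gt0 _; apply: leq_ltn_trans big_L. Qed.

Lemma fits_n3 z : (`|z| <= 2000 * n ^ 3)%N -> (bitlen z <= L)%N.
Proof. by move=> h; apply: fits; apply: leq_trans h _; rewrite leq_pmulr // expn_gt0 c_gt0. Qed.

Lemma fits_c3 z : (`|z| <= 2000 * c ^ 3)%N -> (bitlen z <= L)%N.
Proof.
move=> h; apply: fits; apply: leq_trans h _; rewrite /big mulnAC leq_pmulr //.
by rewrite expn_gt0 n_gt0.
Qed.

Lemma leq_n3 : (n <= n ^ 3)%N. Proof. by rewrite -{1}[n]expn1 leq_pexp2l. Qed.
Lemma leq_c3 : (c <= c ^ 3)%N. Proof. by rewrite -{1}[c]expn1 leq_pexp2l. Qed.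
Lemma leq_c23 : (c ^ 2 <= c ^ 3)%N. Proof. by rewrite leq_pexp2l. Qed.
Lemma n3_gt0 : (0 < n ^ 3)%N. Proof. by rewrite expn_gt0 n_gt0. Qed.

Definition copied (m : memory) :=
  m (Negz rN) = n /\
  forall i, (i < n)%N -> m (Negz (99 + 2 * i)) = (vtx vs i).1
                      /\ m (Negz (100 + 2 * i)) = (vtx vs i).2.

Definition copy_inv (i : nat) (m : memory) :=
  [/\ [/\ m 0 = (2 * n)%N, m (Negz rN) = n & m (Negz rI) = i],
      (i <= 2 * n)%N,
      forall j, (j < 2 * n)%N -> m (Posz j.+1) = (encode_points vs)`_j
    & forall j, (j < i)%N -> m (Negz (99 + j)) = (encode_points vs)`_j].

Definition input := input_memory (encode_points vs).

Lemma nth_input_le j : (`|((encode_points vs)`_j)%R| <= c)%N.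
Proof.
have [h|h] := ltnP j (2 * n); last by rewrite nth_default ?size_encode_points.
have hj : (j %/ 2 < n)%N by lia.
have [e1 e2] := nth_encode_points hj; have [c1 c2] := vs_c (vtx_mem hj).
have [ej|ej] : j = (2 * (j %/ 2))%N \/ j = (2 * (j %/ 2)).+1 by lia.
- by rewrite ej e1.
- by rewrite ej e2.
Qed.

Lemma fits_input j : (bitlen ((encode_points vs)`_j) <= L)%N.
Proof.
apply: fits_c3; apply: leq_trans (nth_input_le j) _; apply: leq_trans leq_c3 _.
exact: leq_pmull.
Qed.

Lemma bnd_input : bnd L input.
Proof.
case=> [[|i]|i] /=; rewrite /input /=.
- by apply: fits_n3; rewrite size_encode_points; have := leq_n3; lia.
- exact: fits_input.
- exact: fits_n3.
Qed.

Lemma run_prologue :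
  runs L prologue (cwork prologue) input (copy_inv 0).
Proof.
apply: (wp_runs L_gt0 bnd_input); rewrite /prologue /set_reg; cbn [wp].
have e : eval input (Op Div (Read (Const 0)) (Const 2)) = n.
  by rewrite /= size_encode_points divz_nat mulKn.
rewrite e; split; first by apply: fits_n3; have := leq_n3; lia.
split; first exact: fits_n3.
split=> //; split=> //; exact: (congr1 Posz (size_encode_points vs)).
Qed.

Lemma run_copy m : bnd L m -> copy_inv 0 m ->
  runs L copy_loop ((2 * n).+1 * (ework copy_guard + cwork copy_body)) m copied.
Proof.
move=> hm h0.
have [||t [m' [x l b [[h1 h2 h3] h4 h5 h6]]]] :=
  @runs_for _ L_gt0 copy_inv copy_guard copy_body (2 * n) m _ _ hm h0.
- by move=> i m' _ [[e0 _ ei] hi _ _]; split=> //=; rewrite e0 ei ltz_nat.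
- move=> i m' hm' [[e0 en ei] hi hin hout] hlt; rewrite /copy_body /incr /set_reg; cbn [wp].
  have ea : eval m' (Op Sub (Const (-100)) (reg rI)) = Negz (99 + i).
    by rewrite /= ei; lia.
  have ev : eval m' (Read (Op Add (Const 1) (reg rI))) = (encode_points vs)`_i.
    by rewrite /= ei -hin //; congr m'; lia.
  rewrite ea ev; split; first exact: fits_input.
  have er : eval (upd m' (Negz (99 + i)) (encode_points vs)`_i) (Op Add (reg rI) (Const 1)) = i.+1.
    by rewrite /= upd_reg /= ei; lia.
  rewrite er; split; first by apply: fits_n3; have := leq_n3; lia.
  split=> [||j hj|j hj].
  + by split; rewrite ?upd_reg //= ?upd_reg_pos.
  + by [].
  + by rewrite !upd_reg_pos hin.
  + rewrite /= !upd_reg eqn_add2l; rewrite (_ : (_ == 2) = false) //.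
    by case: eqP => [->//|ne]; apply: hout; lia.
exists t, m'; split=> //; split=> // i hi.
have [e1 e2] := nth_encode_points hi.
rewrite -e1 -e2 -h6; last by lia.
by rewrite (_ : 100 + 2 * i = 99 + (2 * i).+1)%N ?h6 //; lia.
Qed.

Local Notation tv := (triple_v vs).
Local Notation ta := (triple_a vs).
Local Notation tb := (triple_b vs).
Local Notation tarea t := (area (tv t) (ta t) (tb t)).

Lemma triple_mem t : (t < n ^ 3)%N -> [/\ tv t \in vs, ta t \in vs & tb t \in vs].
Proof.
move=> ht; split; apply: vtx_mem; rewrite -/n ?ltn_mod //.
by rewrite !ltn_divLR //; move: ht; rewrite !expnS expn0 muln1 mulnA.
Qed.

Lemma triple_exists v a b : v \in vs -> a \in vs -> b \in vs ->
  exists2 t, (t < n ^ 3)%N & [/\ tv t = v, ta t = a & tb t = b].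
Proof.
move=> /(nthP 0)[i hi <-] /(nthP 0)[j hj <-] /(nthP 0)[k hk <-].
exists ((k * n + j) * n + i)%N.
  rewrite !expnS expn0 muln1 mulnA; rewrite -/n in hi hj hk.
  apply: (@leq_trans ((k * n + j).+1 * n)); first by rewrite mulSn; lia.
  by rewrite leq_mul2r; apply/orP; right; apply: (@leq_trans (k.+1 * n)); [rewrite mulSn; lia|rewrite leq_mul2r hk orbT].
rewrite /triple_v /triple_a /triple_b -/n modnMDl divnMDl // (divn_small hi) addn0.
by rewrite modnMDl divnMDl // (divn_small hj) addn0 !modn_small.
Qed.

Lemma vtx_diff_le v a : v \in vs -> a \in vs ->
  (`|(a - v)%R.1| <= 2 * c)%N /\ (`|(a - v)%R.2| <= 2 * c)%N.
Proof.
move=> /vs_c[h1 h2] /vs_c[h3 h4].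
by rewrite -[(a - v).1]/(a.1 - v.1) -[(a - v).2]/(a.2 - v.2); lia.
Qed.

Lemma det2_le (x y : pt) d d' : (`|x.1| <= d)%N -> (`|x.2| <= d)%N ->
  (`|y.1| <= d')%N -> (`|y.2| <= d')%N -> (`|det2 x y| <= 2 * (d * d'))%N.
Proof.
move=> h1 h2 h3 h4; rewrite /det2.
have := leq_mul h1 h4; have := leq_mul h2 h3; rewrite -!abszM; lia.
Qed.

Lemma area_le t : (t < n ^ 3)%N -> (`|tarea t| <= 8 * c ^ 2)%N.
Proof.
move=> /triple_mem[hv ha hb]; have [a1 a2] := vtx_diff_le hv ha.
have [b1 b2] := vtx_diff_le hv hb; apply: leq_trans (det2_le a1 a2 b1 b2) _.
by rewrite -mulnn; lia.
Qed.

Definition area_inv (i : nat) (m : memory) :=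
  [/\ base vs m, m (Negz rI) = i, (i <= n ^ 3)%N
    & exists2 t, (t < n ^ 3)%N
      & [/\ m (Negz rT) = t, m (Negz rD) = `|tarea t|%N
          & forall t', (t' < i)%N -> (`|tarea t'| <= `|tarea t|)%N]].

(** Triple 0 repeats one vertex three times; the initial zeros in [rT] and [rD] therefore satisfy
    the invariant. *)
Lemma tarea0 : tarea 0 = 0.
Proof. by rewrite /triple_v /triple_a /triple_b !div0n mod0n /area subrr /det2 /= !mul0r subrr. Qed.

Lemma run_area_init m : bnd L m -> copied m ->
  runs L area_init (cwork area_init) m (area_inv 0).
Proof.
move=> hm [hn hd]; apply: (wp_runs L_gt0 hm); rewrite /area_init /set_reg; cbn [wp].
have e : eval m (Op Mul (Op Mul (reg rN) (reg rN)) (reg rN)) = (n ^ 3)%N.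
  by rewrite /= hn -!PoszM !expnS expn0 muln1 mulnA.
rewrite e; split; first by apply: fits_n3; lia.
split; first exact: fits_n3.
split; first exact: fits_n3.
split; first exact: fits_n3.
split=> //; exists 0%N; first exact: n3_gt0.
by split=> //; rewrite tarea0.
Qed.

Lemma run_area m : bnd L m -> area_inv 0 m ->
  runs L area_loop ((n ^ 3).+1 * (ework area_guard + cwork area_body)) m (area_inv (n ^ 3)).
Proof.
move=> hm h0; apply: (runs_for L_gt0 _ _ hm h0).
  by move=> i m' _ [[_ e3 _] ei hi _]; split=> //=; rewrite e3 ei ltz_nat.
move=> i m' hm' [hb ei hi [t ht [eT eD hmax]]] hlt.
have eI : eval m' (reg rI) = i by [].
have eabs : eval m' (eAbs (eArea (reg rI))) = `|tarea i|%N.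
  by rewrite eval_abs (eval_area hb eI hlt).
have fi (m1 : memory) : m1 (Negz rI) = i -> (bitlen (eval m1 (Op Add (reg rI) (Const 1))) <= L)%N.
  by move=> e1; apply: fits_n3; rewrite /= e1; lia.
have ec : eval m' (Op Lt (reg rD) (eAbs (eArea (reg rI)))) = (`|tarea t| < `|tarea i|)%N.
  by rewrite -[LHS]/((nat_of_bool (eval m' (reg rD) < eval m' (eAbs (eArea (reg rI))))%R)%:Z) eabs /= eD ltz_nat.
rewrite /area_body /incr /set_reg; cbn [wp]; rewrite ec eabs; split; last first.
  case: ltnP => // hle _; split; first exact: fi.
  split; [exact: base_upd| |by []|].
    by rewrite /= upd_reg /= ei; lia.
  exists t => //; split; rewrite ?upd_reg //= => t'.
  by rewrite ltnS leq_eqVlt => /orP[/eqP->|/hmax].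
case: ltnP => // hgt _; split; first by apply: fits_c3; have := area_le hlt; have := leq_c23; lia.
split; first by apply: fits_n3; rewrite /= upd_reg /= ei; lia.
split; first by apply: fi; rewrite !upd_reg.
split; [by do 3![apply: base_upd => //]| |by []|].
  by rewrite /= !upd_reg /= ei; lia.
exists i => //; split; rewrite ?upd_reg //= => t'.
by rewrite ltnS leq_eqVlt => /orP[/eqP->//|/hmax h]; apply: leq_trans h (ltnW hgt).
Qed.

Section Gauss.
Variables (v a b : pt).
Hypotheses (hv : v \in vs) (ha : a \in vs) (hb : b \in vs).
Hypothesis D0 : area v a b != 0.

Let A := a - v.
Let B := b - v.

Definition frame (m : memory) :=
  [/\ base vs m, (m (Negz rAx), m (Negz rAy)) = A
    & (m (Negz rBx), m (Negz rBy)) = B].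

Lemma frame_upd m k z : (8 <= k < 99)%N -> frame m -> frame (upd m (Negz k) z).
Proof.
move=> hk [h0 h1 h2].
have ne k' : (k' < 8)%N -> upd m (Negz k) z (Negz k') = m (Negz k').
  by move=> h; rewrite upd_reg; case: eqP => // e; lia.
by split; rewrite ?ne //; apply: base_upd => //=; lia.
Qed.

Lemma eval_dot m u1 u2 w1 w2 : frame m ->
  eval m (eDotAB u1 u2 w1 w2) =
  qdot A B (eval m u1, eval m u2) (eval m w1, eval m w2).
Proof. by move=> [_ eA' eB']; rewrite -eA' -eB'. Qed.

Definition basis (m : memory) (b1 b2 : pt) :=
  [/\ m (Negz rb1x) = b1.1, m (Negz rb1y) = b1.2, m (Negz rb2x) = b2.1
    & m (Negz rb2y) = b2.2].

Lemma eval_round m b1 b2 : frame m -> basis m b1 b2 ->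
  eval m eRound = nearest A B b1 b2.
Proof.
move=> hf [e1 e2 e3 e4].
transitivity ((2 * eval m (eDotAB (reg rb1x) (reg rb1y) (reg rb2x) (reg rb2y))
  + eval m (eDotAB (reg rb1x) (reg rb1y) (reg rb1x) (reg rb1y))) %/
  (2 * eval m (eDotAB (reg rb1x) (reg rb1y) (reg rb1x) (reg rb1y))))%Z; first by [].
by rewrite !eval_dot //= e1 e2 e3 e4 -!surjective_pairing.
Qed.

(** The bound is that of the initial basis: [qform] of [(1, 0)] or [(0, 1)] is a sum of two squares
    of coordinates of [A] and [B], each coordinate being at most [2 * c]. Neither size reduction nor
    swapping exceeds it. *)
Definition short (u : pt) := qform A B u <= (8 * c ^ 2)%N.

Lemma fits_short u : short u -> (bitlen u.1 <= L)%N /\ (bitlen u.2 <= L)%N.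
Proof.
have [a1 a2] := vtx_diff_le hv ha; have [b1 b2] := vtx_diff_le hv hb.
move=> /(qform_coord_le D0 a1 a2 b1 b2)[h1 h2].
by split; apply: fits_c3; [apply: leq_trans h1 _|apply: leq_trans h2 _]; rewrite leq_mul2r orbT.
Qed.

Definition reduced_diff (m : memory) (t : pt) :=
  m (Negz rtx) = t.1 /\ m (Negz rty) = t.2.

Lemma wp_set_diff m b1 b2 (Q : memory -> Prop) : frame m -> basis m b1 b2 ->
  0 < qform A B b1 -> short b2 ->
  (forall m', frame m' -> basis m' b1 b2 ->
    reduced_diff m' (size_reduce A B b1 b2) -> Q m') ->
  wp L set_diff Q m.
Proof.
move=> hf hbs p0 q2 hQ; have [e1 e2 e3 e4] := hbs.
have [f1 f2] := fits_short (le_trans (qform_size_reduce_le b2 p0) q2).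
have ex : eval m (Op Sub (reg rb2x) (Op Mul eRound (reg rb1x))) = (size_reduce A B b1 b2).1.
  by rewrite -[LHS]/(m (Negz rb2x) - eval m eRound * m (Negz rb1x)) (eval_round hf hbs) e1 e3.
rewrite /set_diff /set_reg; cbn [wp]; rewrite ex; split=> //.
set m1 := upd m _ _.
have hf1 : frame m1 by apply: frame_upd.
have hb1 : basis m1 b1 b2 by [].
(* The rounded quotient is evaluated a second time after [rtx] has changed; it does not read that
   register, so the value is the same. *)
have ey : eval m1 (Op Sub (reg rb2y) (Op Mul eRound (reg rb1y))) = (size_reduce A B b1 b2).2.
  by rewrite -[LHS]/(m (Negz rb2y) - eval m1 eRound * m (Negz rb1y)) (eval_round hf1 hb1) e2 e4.
rewrite ey; split=> //; apply: hQ => //; exact: frame_upd.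
Qed.

(** The exponent [k] is the fuel for [runs_while]: a round replaces [b1] by a vector of less than
    half its norm, and positivity of the norm excludes a round at [k = 0]. *)
Definition gauss_inv (k : nat) (m : memory) :=
  exists b1 b2,
  [/\ frame m, basis m b1 b2, reduced_diff m (size_reduce A B b1 b2),
      `|det2 b1 b2| = 1
    & [/\ short b1, short b2 & qform A B b1 < (2 ^ k)%N]].

Lemma qform_basis_gt0 b1 b2 : `|det2 b1 b2| = 1 -> 0 < qform A B b1.
Proof. by move=> h; rewrite qform_gt0 // (basis_neq0 h). Qed.

Definition gauss_done (m : memory) (b1 b2 : pt) :=
  [/\ base vs m, (m (Negz rb1x), m (Negz rb1y)) = b1, (m (Negz rtx), m (Negz rty)) = b2
    & [/\ `|det2 b1 b2| = 1, 2 * `|qdot A B b1 b2| <= qform A B b1,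
          qform A B b1 <= 2 * qform A B b2, short b1 & short b2]].

Lemma run_gauss_init m (t : nat) : bnd L m -> base vs m -> m (Negz rT) = t -> (t < n ^ 3)%N ->
  v = triple_v vs t -> a = triple_a vs t -> b = triple_b vs t ->
  runs L gauss_init (cwork gauss_init) m (gauss_inv L).
Proof.
move=> hm hbase eT ht ev ea eb; apply: (wp_runs L_gt0 hm).
have [a1 a2] := vtx_diff_le hv ha; have [b1 b2] := vtx_diff_le hv hb.
have fit z : (`|z| <= 2 * c)%N -> (bitlen z <= L)%N.
  move=> h; apply: fits_c3; apply: leq_trans h _.
  by rewrite leq_mul // leq_c3.
have AB m' : base vs m' -> m' (Negz rT) = t ->
    [/\ eval m' (eAx (reg rT)) = A.1, eval m' (eAy (reg rT)) = A.2,
        eval m' (eBx (reg rT)) = B.1 & eval m' (eBy (reg rT)) = B.2].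
  move=> hb' eT'; have [] := eval_AB hb' (eT' : eval m' (reg rT) = t) ht.
  by rewrite -ev -ea -eb -/A -/B => <- <-.
rewrite /gauss_init /set_reg; cbn [wp].
have [-> _ _ _] := AB _ hbase eT; split; first exact: fit.
set m1 := upd m _ _; have h1 : base vs m1 by apply: base_upd.
have [_ -> _ _] := AB _ h1 eT; split; first exact: fit.
set m2 := upd m1 _ _; have h2 : base vs m2 by apply: base_upd.
have [_ _ -> _] := AB _ h2 eT; split; first exact: fit.
set m3 := upd m2 _ _; have h3 : base vs m3 by apply: base_upd.
have [_ _ _ ->] := AB _ h3 eT; split; first exact: fit.
set m4 := upd m3 _ _; have h4 : frame m4.
  by split; [apply: base_upd| |]; rewrite /= ?upd_reg /= -?surjective_pairing.
do 4 (split; first by apply: fit; rewrite /=; lia).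
set m5 := upd m4 _ _; set m6 := upd m5 _ _; set m7 := upd m6 _ _; set m8 := upd m7 _ _.
have h8 : frame m8 by do 4 (apply: frame_upd => //).
have e8 : basis m8 (1, 0) (0, 1) by [].
have d1 : `|det2 (1, 0) (0, 1)| = 1 by [].
have sq x : (`|x| <= 2 * c)%N -> x * x <= (4 * c ^ 2)%N.
  move=> h; have := leq_mul h h; rewrite -abszM -mulnn; lia.
have q1 : short (1, 0).
  have := sq _ a2; have := sq _ b2; rewrite /short /qform /qdot /det2 /=; lia.
have q2 : short (0, 1).
  have := sq _ a1; have := sq _ b1; rewrite /short /qform /qdot /det2 /=; lia.
apply: (wp_set_diff h8 e8 (qform_basis_gt0 d1) q2) => m9 h9 e9 r9.
exists (1, 0), (0, 1); split=> //; split=> //.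
apply: le_lt_trans q1 _; rewrite ltz_nat; apply: leq_ltn_trans big_L.
rewrite /big mulnAC; apply: (@leq_trans (2000 * c ^ 3)%N); last by rewrite leq_pmulr // expn_gt0 n_gt0.
by rewrite leq_mul // leq_c23.
Qed.

Lemma run_gauss m : bnd L m -> gauss_inv L m ->
  runs L gauss_loop (L.+1 * (ework gauss_guard + cwork gauss_body)) m
    (fun m' => exists b1 b2, gauss_done m' b1 b2).
Proof.
move=> hm h0.
have ee m' b1 b2 : frame m' -> basis m' b1 b2 -> reduced_diff m' (size_reduce A B b1 b2) ->
    eval m' gauss_guard = nat_of_bool (2 * qform A B (size_reduce A B b1 b2) < qform A B b1).
  move=> hf [e1 e2 _ _] [e3 e4].
  rewrite -[LHS]/((nat_of_bool (2 * eval m' (eDotAB (reg rtx) (reg rty) (reg rtx) (reg rty))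
      < eval m' (eDotAB (reg rb1x) (reg rb1y) (reg rb1x) (reg rb1y)))%R)%:Z).
  by rewrite !eval_dot //= e1 e2 e3 e4 -!surjective_pairing.
have [|t [m' [x l bd [[k [b1 [b2 [hf hbs hr d1 [hq1 hq2 _]]]]] ex]]]] :=
  @runs_while _ L_gt0 gauss_inv gauss_guard gauss_body L m _ hm h0; last first.
  have p1 := qform_basis_gt0 d1.
  exists t, m'; split=> //; exists b1, (size_reduce A B b1 b2).
  have [e1 e2 _ _] := hbs; have [e3 e4] := hr; have [hbase _ _] := hf.
  split; rewrite ?e1 ?e2 ?e3 ?e4 -?surjective_pairing //; split.
  - by rewrite det2_size_reduce.
  - exact: qdot_size_reduce_le.
  - by move: ex; rewrite (ee _ _ _ hf hbs hr); case: ltP.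
  - by [].
  - exact: le_trans (qform_size_reduce_le b2 p1) hq2.
move=> k m' hm' [b1 [b2 [hf hbs hr d1 [hq1 hq2 hk]]]].
rewrite (ee _ _ _ hf hbs hr); case: ltP => // hlt _.
have p1 := qform_basis_gt0 d1; case: k hk => [|k] hk; first by rewrite expn0 in hk; lia.
exists k => //; have [e1 e2 e3 e4] := hbs; have [e5 e6] := hr.
have hq3 := le_trans (qform_size_reduce_le b2 p1) hq2.
have [f1 f2] := fits_short hq1; have [f3 f4] := fits_short hq3.
set b3 := size_reduce A B b1 b2 in e5 e6 f3 f4 hlt hq3 *.
have d3 : `|det2 b3 b1| = 1.
  rewrite (_ : det2 b3 b1 = - det2 b1 b3); last by rewrite /det2; ring.
  by rewrite normrN det2_size_reduce.
rewrite /gauss_body /set_reg; cbn [wp].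
do 4 (split; first by rewrite /= ?upd_reg /= ?e1 ?e2 ?e5 ?e6).
set m1 := upd m' _ _; set m2 := upd m1 _ _; set m3 := upd m2 _ _; set m4 := upd m3 _ _.
have h4 : frame m4 by do 4 (apply: frame_upd => //).
have b4 : basis m4 b3 b1 by split; rewrite /= ?upd_reg /= ?upd_reg.
apply: (wp_set_diff h4 b4 (qform_basis_gt0 d3) hq1) => m5 h5 b5 r5.
exists b3, b1; split=> //; split=> //.
by move: hk; rewrite expnS; move: hlt; lia.
Qed.

Section Search.
Variables b1 b2 : pt.
Hypotheses (hb1 : short b1) (hb2 : short b2).

Definition search_state (m : memory) :=
  [/\ base vs m, (m (Negz rb1x), m (Negz rb1y)) = b1
    & (m (Negz rtx), m (Negz rty)) = b2].

Lemma search_upd m x z : scratch x ->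
  (if x is Negz k then k \notin [:: rb1x; rb1y; rtx; rty] else true) ->
  search_state m -> search_state (upd m x z).
Proof.
move=> h1 h2 [h e1 e2].
have ne k : k \in [:: rb1x; rb1y; rtx; rty] -> upd m x z (Negz k) = m (Negz k).
  by rewrite /upd; case: eqP h2 => // <- /negPf ->.
by split; rewrite ?ne //; apply: base_upd.
Qed.

Definition cell_c j := (16 + j %/ n ^ 3)%N.
Definition cell_t j := (j %% n ^ 3)%N.
Definition cell_u j := cand b1 b2 (cell_c j).
Definition cell_reach j :=
  reach (cell_u j) (tv (cell_t j)) (ta (cell_t j)) (tb (cell_t j)).

Let N := (480 * n ^ 3)%N.

Lemma cell_c_range j : (j < N)%N -> (16 <= cell_c j < 496)%N.
Proof. by move=> hj; have : (j %/ n ^ 3 < 480)%N by rewrite ltn_divLR ?n3_gt0. Qed.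

Lemma cell_t_lt j : (cell_t j < n ^ 3)%N.
Proof. by rewrite ltn_mod n3_gt0. Qed.

Lemma cell_exists k v' a' b' : (16 <= k < 496)%N ->
  v' \in vs -> a' \in vs -> b' \in vs ->
  exists2 j, (j < N)%N & [/\ cell_c j = k, tv (cell_t j) = v',
     ta (cell_t j) = a' & tb (cell_t j) = b'].
Proof.
move=> hk h1 h2 h3; have [t ht [e1 e2 e3]] := triple_exists h1 h2 h3.
exists ((k - 16) * n ^ 3 + t)%N.
  apply: (@leq_trans ((k - 16).+1 * n ^ 3)%N); first by rewrite mulSn; lia.
  by rewrite leq_mul2r; apply/orP; right; lia.
rewrite /cell_c /cell_t modnMDl divnMDl ?n3_gt0 // (divn_small ht) modn_small // addn0.
by split=> //; lia.
Qed.

Lemma cell_u_fits j : (j < N)%N ->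
  (`|(cell_u j).1| <= 480 * c ^ 3)%N /\ (`|(cell_u j).2| <= 480 * c ^ 3)%N.
Proof.
move=> /cell_c_range hc; rewrite /cell_u /cand.
have [a1 a2] := vtx_diff_le hv ha; have [d1 d2] := vtx_diff_le hv hb.
have [p1 p2] := qform_coord_le D0 a1 a2 d1 d2 hb1.
have [p3 p4] := qform_coord_le D0 a1 a2 d1 d2 hb2.
set x := _ - 15; set y := Posz _.
have hx : (`|x| <= 15)%N by rewrite /x; lia.
have hy : (`|y| <= 15)%N by rewrite /y; lia.
have gen p q : (`|p| <= 16 * c ^ 3)%N -> (`|q| <= 16 * c ^ 3)%N ->
    (`|(x * p + y * q)%R| <= 480 * c ^ 3)%N.
  move=> hp hq; apply: leq_trans (absz_addle _ _) _; rewrite !abszM.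
  by have := leq_mul hx hp; have := leq_mul hy hq; lia.
by split; apply: gen.
Qed.

Lemma cell_reach_fits j : (cell_reach j <= 8 * c ^ 2)%N.
Proof.
apply: leq_trans (area_le (cell_t_lt j)).
have [->//|r0] := posnP (cell_reach j); have [_ _ s0] := reach_gt0 r0.
by apply: leq_trans (reach_bound _ _ _ _); apply: leq_pmulr; rewrite absz_gt0.
Qed.

Section EvalCell.
Variables (m : memory) (j : nat).
Hypotheses (hm : search_state m) (ej : m (Negz rI) = j).

Lemma eval_c : eval m eC = cell_c j.
Proof.
have [[_ e3 _] _ _] := hm.
by rewrite -[LHS]/(16 + (m (Negz rI) %/ m (Negz rN3))%Z) ej e3 divz_nat.
Qed.

Lemma eval_tri : eval m eTri = cell_t j.
Proof. by have [[_ e3 _] _ _] := hm; apply: eval_mod. Qed.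

Lemma eval_u : eval m (eU rb1x rtx) = (cell_u j).1 /\ eval m (eU rb1y rty) = (cell_u j).2.
Proof.
have [_ e1 e2] := hm; rewrite /cell_u /cand /lin -e1 -e2 /=.
have em : eval m (eMod eC (Const 31)) = (cell_c j %% 31)%N by apply: eval_mod eval_c _.
have ed : eval m (Op Div eC (Const 31)) = (cell_c j %/ 31)%N by apply: eval_div eval_c _.
split.
- by rewrite -[LHS]/((eval m (eMod eC (Const 31)) - 15) * m (Negz rb1x)
    + eval m (Op Div eC (Const 31)) * m (Negz rtx)) em ed.
- by rewrite -[LHS]/((eval m (eMod eC (Const 31)) - 15) * m (Negz rb1y)
    + eval m (Op Div eC (Const 31)) * m (Negz rty)) em ed.
Qed.

Lemma eval_R : (m (Negz rUx), m (Negz rUy)) = cell_u j -> eval m eR = cell_reach j.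
Proof.
by move=> eu; have [hbase _ _] := hm; rewrite (eval_reach hbase eval_tri (cell_t_lt j)) /= eu.
Qed.

Lemma eval_cell_v : (eval m (eX (eV eTri)), eval m (eY (eV eTri))) = tv (cell_t j).
Proof. by have [hbase _ _] := hm; apply: eval_v hbase eval_tri (cell_t_lt j). Qed.

End EvalCell.

Lemma wp_set_u m (j : nat) (Q : memory -> Prop) : search_state m -> m (Negz rI) = j ->
  (j < N)%N ->
  (forall m', search_state m' -> m' (Negz rI) = j ->
     (m' (Negz rUx), m' (Negz rUy)) = cell_u j ->
     (forall k, (k < 18)%N -> m' (Negz k) = m (Negz k)) ->
     (forall k, m' (Posz k) = m (Posz k)) -> Q m') ->
  wp L set_u Q m.
Proof.
move=> hm ej hj hQ; have [f1 f2] := cell_u_fits hj.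
have fit z : (`|z| <= 480 * c ^ 3)%N -> (bitlen z <= L)%N.
  by move=> h; apply: fits_c3; apply: leq_trans h _; rewrite leq_mul2r orbT.
rewrite /set_u /set_reg; cbn [wp].
have [-> _] := eval_u hm ej; split; first exact: fit.
set m1 := upd m _ _; have hm1 : search_state m1 by apply: search_upd.
have [_ ->] := eval_u hm1 (ej : m1 (Negz rI) = j); split; first exact: fit.
apply: hQ.
- exact: search_upd.
- by [].
- by rewrite upd_reg /= -surjective_pairing.
- move=> k hk; have e18 : (k == 18%N) = false by lia.
  have e19 : (k == 19%N) = false by lia.
  by rewrite upd_reg e19 /m1 upd_reg e18.
- by [].
Qed.

Lemma eval_cand_guard m (i : nat) : search_state m -> m (Negz rI) = i ->
  eval m cand_guard = nat_of_bool (i < N)%N.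
Proof.
move=> [[_ e3 _] _ _] ei.
by rewrite -[LHS]/((nat_of_bool (m (Negz rI) < 480 * m (Negz rN3))%R)%:Z) ei e3 -PoszM ltz_nat.
Qed.

Lemma incr_fits (m : memory) k (i : nat) : m (Negz k) = i -> (i <= N)%N ->
  (bitlen (eval m (Op Add (reg k) (Const 1))) <= L)%N.
Proof. by move=> /= -> hi; apply: fits_n3; have := n3_gt0; rewrite /N in hi *; lia. Qed.

Definition best_inv (i : nat) (m : memory) :=
  [/\ search_state m, m (Negz rI) = i, (i <= N)%N
    & exists best : nat,
      [/\ m (Negz rBest) = best, forall j, (j < i)%N -> (cell_reach j <= best)%N
        & best = 0%N \/ exists2 j, (j < i)%N & cell_reach j = best]].

Lemma run_best_init m : bnd L m -> search_state m ->
  runs L best_init (cwork best_init) m (best_inv 0).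
Proof.
move=> hm hs; apply: (wp_runs L_gt0 hm); rewrite /best_init /set_reg; cbn [wp].
do 2 (split; first exact: fits_n3).
by split=> //; exists 0%N; split=> //; left.
Qed.

Lemma run_best m : bnd L m -> best_inv 0 m ->
  runs L best_loop (N.+1 * (ework cand_guard + cwork best_body)) m (best_inv N).
Proof.
move=> hm h0; apply: (runs_for L_gt0 _ _ hm h0).
  by move=> i m' _ [hs ei hi _]; split=> //; apply: eval_cand_guard.
move=> i m' hm' [hs ei hi [best [eb hmax hex]]] hlt.
rewrite /best_body /incr /set_reg; cbn [wp].
apply: (wp_set_u hs ei hlt) => m1 hs1 ei1 eu1 eq1 _.
have eb1 : m1 (Negz rBest) = best by rewrite eq1.
have eR' := eval_R hs1 ei1 eu1.
have ec : eval m1 (Op Lt (reg rBest) eR) = nat_of_bool (best < cell_reach i)%N.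
  by rewrite -[LHS]/((nat_of_bool (m1 (Negz rBest) < eval m1 eR)%R)%:Z) eR' eb1 ltz_nat.
rewrite ec eR'; split; case: ltnP => // hle _; last first.
  split; first exact: incr_fits ei1 hi.
  split; [exact: search_upd| |by []|]; first by rewrite upd_reg /= ei1; lia.
  exists best; split=> // [j|].
    by rewrite ltnS leq_eqVlt => /orP[/eqP->|/hmax].
  by case: hex => [->|[j hj <-]]; [left|right; exists j => //; exact: ltnW].
split; first by apply: fits_c3; apply: leq_trans (cell_reach_fits i) _; rewrite leq_mul ?leq_c23.
split; first by apply: (incr_fits _ hi); rewrite upd_reg.
split; [by do 2 (apply: search_upd => //)| |by []|]; first by rewrite /= !upd_reg /= ei1; lia.
exists (cell_reach i); split=> // [j|]; last by right; exists i.
by rewrite ltnS leq_eqVlt => /orP[/eqP->//|/hmax h]; apply: leq_trans h (ltnW hle).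
Qed.

Section Emit.
Variable best : nat.

(** After [i] cells, [hs] lists the direction index and starting vertex of each line output. The
    value [last = 0] stands for no output yet, since real indices are at least 16. *)
Definition hits_ok (i : nat) (hs : seq (nat * pt)) (last : nat) :=
  [/\ [/\ uniq (unzip1 hs), (size hs <= i)%N & last = 0%N \/ last \in unzip1 hs],
      forall h, h \in hs -> exists2 j, (j < i)%N &
        cell_reach j = best /\ h = (cell_c j, tv (cell_t j)),
      forall j, (j < i)%N -> cell_reach j = best -> cell_c j \in unzip1 hs
    & forall k, k \in unzip1 hs -> (k <= last)%N].

Lemma hits_last i hs last k : hits_ok i hs last -> k \in unzip1 hs -> (k <= cell_c i)%N.
Proof.
move=> [_ snd _ _] /mapP[h /snd[j hj [_ ->]] ->] /=.
by rewrite leq_add2l leq_div2r // ltnW.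
Qed.

Lemma hits_skip i hs last : hits_ok i hs last ->
  (cell_reach i = best -> cell_c i = last) -> hits_ok i.+1 hs last.
Proof.
move=> [[h1 h2 h3] h4 h5 h6] hi; split=> //.
- by split=> //; apply: leqW.
- by move=> h /h4[j hj e]; exists j => //; apply: ltnW.
- move=> j; rewrite ltnS leq_eqVlt => /orP[/eqP-> /hi e|/h5//].
  (* A cell that attains [best] is never skipped while [last] is 0, as its index is at least 16. *)
  by case: h3 => [l0|]; [move: e; rewrite l0 /cell_c; lia|rewrite e].
Qed.

(** An index already listed is at most [last], and [last] is at most the current index because
    indices never decrease; a repeated index would therefore equal [last]. *)
Lemma hits_add i hs last : hits_ok i hs last -> cell_reach i = best ->
  cell_c i <> last ->
  hits_ok i.+1 (rcons hs (cell_c i, tv (cell_t i))) (cell_c i).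
Proof.
move=> ok e ne; have hl := hits_last ok; have [[h1 h2 h3] h4 h5 h6] := ok.
have new : cell_c i \notin unzip1 hs.
  apply/negP => hin; apply: ne; apply/eqP; rewrite eqn_leq h6 //=.
  by case: h3 => [->|]; [|apply: hl].
rewrite /hits_ok /unzip1 map_rcons /=; split.
- by rewrite rcons_uniq new h1 size_rcons ltnS mem_rcons inE eqxx; split=> //; right.
- move=> h; rewrite mem_rcons inE => /orP[/eqP->|/h4[j hj e']]; first by exists i.
  by exists j => //; apply: ltnW.
- move=> j; rewrite mem_rcons inE ltnS leq_eqVlt => /orP[/eqP->|/h5 h /h ->].
    by rewrite eqxx.
  by rewrite orbT.
- by move=> k; rewrite mem_rcons inE => /orP[/eqP->|/hl].
Qed.

Definition hit_lines (hs : seq (nat * pt)) :=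
  [seq (h.2, h.2 + cand b1 b2 h.1) | h <- hs].

Definition emit_inv (i : nat) (m : memory) :=
  [/\ search_state m, m (Negz rI) = i, (i <= N)%N, m (Negz rBest) = best
    & exists hs last,
      [/\ hits_ok i hs last, m (Negz rLast) = Posz last, m (Negz rCnt) = size hs
        & forall k, (k < 4 * size hs)%N ->
            m (Posz k.+1) = (encode_lines (hit_lines hs))`_k]].

Lemma run_emit_init m : bnd L m -> search_state m -> m (Negz rBest) = best ->
  runs L emit_init (cwork emit_init) m (emit_inv 0).
Proof.
move=> hm hs eb; apply: (wp_runs L_gt0 hm); rewrite /emit_init /set_reg; cbn [wp].
do 3 (split; first exact: fits_n3).
by split=> //; exists [::], 0%N; split=> //; split=> //; split=> //; left.
Qed.

Lemma run_emit m : bnd L m -> emit_inv 0 m ->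
  runs L emit_loop (N.+1 * (ework cand_guard + cwork emit_body)) m (emit_inv N).
Proof.
move=> hm h0; apply: (runs_for L_gt0 _ _ hm h0).
  by move=> i m' _ [hs ei hi _ _]; split=> //; apply: eval_cand_guard.
move=> i m' hm' [hs ei hi eb [hits [last [ok el ecnt eout]]]] hlt.
rewrite /emit_body /incr /set_reg; cbn [wp].
apply: (wp_set_u hs ei hlt) => m1 hs1 ei1 eu1 eq1 eqp1.
have eb1 : m1 (Negz rBest) = best by rewrite eq1.
have el1 : m1 (Negz rLast) = last by rewrite eq1.
have ec1 : m1 (Negz rCnt) = size hits by rewrite eq1.
have eR' := eval_R hs1 ei1 eu1; have eC' := eval_c hs1 ei1.
rewrite -[eval m1 (Op Sub eR _)]/(eval m1 eR - m1 (Negz rBest)) eR' eb1.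
have skip : (cell_reach i = best -> cell_c i = last) ->
    (bitlen (eval m1 (Op Add (reg rI) (Const 1))) <= L)%N /\
    emit_inv i.+1 (upd m1 (eval m1 (Const (Negz rI))) (eval m1 (Op Add (reg rI) (Const 1)))).
  move=> hsk; split; first exact: incr_fits ei1 hi.
  split; [exact: search_upd| |by []|by []|]; first by rewrite /= upd_reg /= ei1; lia.
  exists hits, last; split=> //; first exact: hits_skip.
  by move=> k hk; rewrite upd_reg_pos eqp1 eout.
split=> [ne|eq]; first by apply: skip => e; move: ne; rewrite e subrr.
have {}eq : cell_reach i = best by lia.
rewrite -[eval m1 (Op Sub eC _)]/(eval m1 eC - m1 (Negz rLast)) eC' el1.
split=> [ne|eq']; last by apply: skip => _; lia.
have {}ne : cell_c i <> last by lia.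
have [[_ hsz _] _ _ _] := ok.
rewrite /emit /incr /set_reg; cbn [wp].
have ea (m2 : memory) (k : nat) : m2 (Negz rCnt) = size hits ->
    eval m2 (out_addr (Posz k)) = (4 * size hits + k)%N.
  by move=> /= ->; rewrite -PoszM -PoszD.
have vfit : (`|(tv (cell_t i)).1| <= c)%N /\ (`|(tv (cell_t i)).2| <= c)%N.
  by apply: vs_c; have [] := triple_mem (cell_t_lt i).
have [f1 f2] := cell_u_fits hlt.
have fit z : (`|z| <= 481 * c ^ 3)%N -> (bitlen z <= L)%N.
  by move=> h; apply: fits_c3; apply: leq_trans h _; rewrite leq_mul2r orbT.
have cc3 := leq_c3.
have val (m2 : memory) : search_state m2 -> m2 (Negz rI) = i ->
   (m2 (Negz rUx), m2 (Negz rUy)) = cell_u i ->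
   [/\ eval m2 (eX (eV eTri)) = (tv (cell_t i)).1,
       eval m2 (eY (eV eTri)) = (tv (cell_t i)).2,
       eval m2 (Op Add (eX (eV eTri)) (reg rUx)) = (tv (cell_t i) + cell_u i).1
     & eval m2 (Op Add (eY (eV eTri)) (reg rUy)) = (tv (cell_t i) + cell_u i).2].
  move=> hs2 ei2 eu2; have := eval_cell_v hs2 ei2.
  by rewrite -[eval m2 (Op Add _ (reg rUx))]/(eval m2 (eX (eV eTri)) + m2 (Negz rUx))
    -[eval m2 (Op Add _ (reg rUy))]/(eval m2 (eY (eV eTri)) + m2 (Negz rUy)) -eu2 => <-.
have [-> _ _ _] := val _ hs1 ei1 eu1; rewrite (ea m1 1%N ec1).
split; first by apply: fit; lia.
set m2 := upd m1 _ _; have hs2 : search_state m2 by apply: search_upd.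
have [_ -> _ _] := val _ hs2 ei1 eu1; rewrite (ea m2 2%N ec1).
split; first by apply: fit; lia.
set m3 := upd m2 _ _; have hs3 : search_state m3 by apply: search_upd.
have [_ _ -> _] := val _ hs3 ei1 eu1; rewrite (ea m3 3%N ec1).
split; first by apply: fit; rewrite -[(_ + _).1]/((tv (cell_t i)).1 + (cell_u i).1); lia.
set m4 := upd m3 _ _; have hs4 : search_state m4 by apply: search_upd.
have [_ _ _ ->] := val _ hs4 ei1 eu1; rewrite (ea m4 4%N ec1).
split; first by apply: fit; rewrite -[(_ + _).2]/((tv (cell_t i)).2 + (cell_u i).2); lia.
set m5 := upd m4 _ _; have hs5 : search_state m5 by apply: search_upd.
rewrite (eval_c hs5 (ei1 : m5 (Negz rI) = i)).
split; first by apply: fits_n3; have := cell_c_range hlt; have := n3_gt0; lia.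
set m6 := upd m5 _ _; have hs6 : search_state m6 by apply: search_upd.
split; first by apply: (@incr_fits m6 rCnt (size hits) ec1); apply: leq_trans hsz hi.
set m7 := upd m6 _ _; have hs7 : search_state m7 by apply: search_upd.
split; first by apply: (@incr_fits m7 rI i ei1).
split; [exact: search_upd| |by []|by []|].
  by rewrite -[LHS]/(m1 (Negz rI) + 1) ei1; lia.
exists (rcons hits (cell_c i, tv (cell_t i))), (cell_c i); split=> //.
- exact: hits_add ok eq ne.
- by rewrite -[LHS]/(m1 (Negz rCnt) + 1) ec1 size_rcons; lia.
move=> k; rewrite size_rcons => hk.
rewrite /hit_lines map_rcons encode_lines_rcons nth_cat size_encode_lines size_map /=.
rewrite upd_reg_pos /m7 upd_reg_pos /m6 upd_reg_pos /m5 /m4 /m3 /m2 /upd.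
set s := (4 * size hits)%N in hk eout *.
(* Address 0 is kept for the length, so entry [k] sits at address [k + 1]: the four writes fill the
   entries [s] to [s + 3] and leave the earlier ones alone. *)
case: ltnP => hk'.
  have F (d : nat) : (0 < d)%N -> (Posz k.+1 == Posz (s + d)) = false by lia.
  by rewrite !F // eqp1 eout.
have G (e : nat) : (Posz k.+1 == Posz (s + e.+1)) = (k - s == e)%N by lia.
rewrite !G; have : (k - s < 4)%N by rewrite /s in hk' *; lia.
by case: (k - s)%N => [|[|[|[|]]]].
Qed.

End Emit.
End Search.

End Gauss.

End Run.

(** * Correctness and cost of the two programs *)

Section FindBest.
Variables (vs : seq pt) (c L : nat).
Let n := size vs.
Hypotheses (n_gt0 : (0 < n)%N) (c_gt0 : (0 < c)%N).
Hypothesis big_L : (2000 * n ^ 3 * c ^ 3 < 2 ^ L)%N.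
Hypothesis vs_c : forall v, v \in vs -> (`|v.1| <= c)%N /\ (`|v.2| <= c)%N.
Hypothesis spanning : exists v a b,
  [/\ v \in vs, a \in vs, b \in vs & area v a b != 0].

Let N := (480 * n ^ 3)%N.
Let L0 := L_gt0 n_gt0 c_gt0 big_L.

Definition candidates_ok (b1 b2 : pt) (best : nat) :=
  [/\ (0 < best)%N,
      forall u p q r, p \in vs -> q \in vs -> r \in vs -> (reach u p q r <= best)%N,
      exists2 j, (j < N)%N & cell_reach vs b1 b2 j = best,
      forall u p q r, p \in vs -> q \in vs -> r \in vs -> reach u p q r = best ->
        exists2 k, (16 <= k < 496)%N & u = cand b1 b2 k \/ - u = cand b1 b2 k
    & forall k k', (16 <= k < 496)%N -> (16 <= k' < 496)%N ->
        cand b1 b2 k = cand b1 b2 k' \/ cand b1 b2 k = - cand b1 b2 k' -> k = k'].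

Definition found (m : memory) :=
  exists v a b b1 b2 best,
  [/\ [/\ v \in vs, a \in vs, b \in vs & area v a b != 0],
      short c v a b b1, short c v a b b2, candidates_ok b1 b2 best
    & search_state vs b1 b2 m /\ m (Negz rBest) = Posz best].

Definition find_best_work : nat :=
  (cwork prologue + (2 * n).+1 * (ework copy_guard + cwork copy_body) +
   (cwork area_init + (n ^ 3).+1 * (ework area_guard + cwork area_body)) +
   (cwork gauss_init + L.+1 * (ework gauss_guard + cwork gauss_body) +
    (cwork best_init + N.+1 * (ework cand_guard + cwork best_body)))).

Lemma run_find_best : runs L find_best find_best_work (input vs) found.
Proof.
apply: runs_seq.
  apply: runs_seq.
    apply: runs_seq; first exact: (run_prologue n_gt0 c_gt0 big_L vs_c).
    by move=> m bm; apply: (run_copy n_gt0 c_gt0 big_L vs_c bm).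
  move=> m bm hm; apply: runs_seq; first exact: (run_area_init n_gt0 c_gt0 big_L bm hm).
  by move=> m1 bm1; apply: (run_area n_gt0 c_gt0 big_L vs_c bm1).
move=> m bm [hbase _ _ [t ht [eT _ hmax]]].
have [hv ha hb] := triple_mem n_gt0 ht.
move ev : (triple_v vs t) hv hmax => v hv hmax.
move ea : (triple_a vs t) ha hmax => a ha hmax.
move eb : (triple_b vs t) hb hmax => b hb hmax.
have Dmax v' a' b' : v' \in vs -> a' \in vs -> b' \in vs ->
    (`|area v' a' b'| <= `|area v a b|)%N.
  move=> h1 h2 h3; have [t' ht' [<- <- <-]] := triple_exists n_gt0 c_gt0 big_L h1 h2 h3.
  exact: hmax.
have D0 : area v a b != 0.
  have [v' [a' [b' [h1 h2 h3 D1]]]] := spanning.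
  by rewrite -absz_gt0; apply: leq_trans (Dmax _ _ _ h1 h2 h3); rewrite absz_gt0.
apply: (@runs_seq _ _ _ _ _ _ (fun m' => exists b1 b2, gauss_done vs c v a b m' b1 b2)).
  apply: runs_seq; first exact: (run_gauss_init n_gt0 c_gt0 big_L vs_c hv ha hb D0 bm hbase eT ht).
  by move=> m1 bm1; apply: (run_gauss n_gt0 c_gt0 big_L vs_c hv ha hb D0 bm1).
move=> m1 bm1 [b1 [b2 [hbase1 e1 e2 [d1 hdot hlen q1 q2]]]].
have hs1 : search_state vs b1 b2 m1 by [].
have [tt [m2 [x l bm2 [hs2 _ _ [best [ebest hle hex]]]]]] :
  runs L (Seq best_init best_loop) (cwork best_init + N.+1 * (ework cand_guard + cwork best_body)) m1 (best_inv vs b1 b2 N).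
  apply: runs_seq; first exact: (run_best_init n_gt0 c_gt0 big_L bm1 hs1).
  by move=> m2 bm2; apply: (run_best n_gt0 c_gt0 big_L vs_c hv ha hb D0 q1 q2 bm2).
exists tt, m2; split=> //; exists v, a, b, b1, b2, best; split=> //.
have bmax : forall u p q r, p \in vs -> q \in vs -> r \in vs -> (reach u p q r <= best)%N.
  apply: (cand_max hv ha hb D0 Dmax d1 hdot hlen) => k p q r hk hp hq hr.
  have [j hj [<- <- <- <-]] := cell_exists n_gt0 c_gt0 big_L hv ha hb D0 q1 q2 hk hp hq hr.
  exact: hle.
have best_gt0 : (0 < best)%N.
  by apply: leq_trans (bmax (a - v) v a b hv ha hb); apply: reach_pos.
split=> //.
- by case: hex => [z|hex]; [move: best_gt0; rewrite z|exact: hex].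
- by move=> u p q r; apply: (cand_all hv ha hb D0 Dmax d1 hdot hlen best_gt0 bmax).
- by move=> k k' hk hk'; apply: (cand_inj hv ha hb D0 d1 hdot hlen hk hk').
Qed.

Lemma run_diameter (R : realType) (P : set 'rV[R]_2) :
  lattice_polygon P -> vertex_list P vs ->
  runs L diameter_prog (find_best_work + (cwork (Write (Const 1) (reg rBest)) + cwork (Write (Const 0) (Const 1)))) (input vs)
    (fun m => exists2 out, holds_output m out & outputs_lattice_diameter P out).
Proof.
move=> hP hvs; apply: runs_seq run_find_best _ => m bm.
move=> [v [a [b [b1 [b2 [best [[hv ha hb D0] q1 q2 [k0 kmax [j hj ej] _ _] [hs eb]]]]]]]].
have hfit : (best <= 8 * c ^ 2)%N.
  by rewrite -ej; apply: (cell_reach_fits n_gt0 c_gt0 big_L vs_c).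
rewrite /diameter_prog; apply: (wp_runs L0 bm); cbn [wp].
rewrite [eval m _](_ : _ = Posz best) //; split.
  apply: (fits_c3 n_gt0 c_gt0 big_L); apply: leq_trans hfit _.
  by rewrite leq_mul // leq_c23.
split; first by apply: (fits_n3 n_gt0 c_gt0 big_L); rewrite /=; have := n3_gt0 n_gt0; lia.
exists [:: Posz best]; first by split=> // -[|].
exists best => //; have [h1 h2 h3] := triple_mem n_gt0 (cell_t_lt n_gt0 j).
exact: (best_diameter hP hvs k0 kmax h1 h2 h3 ej).
Qed.

Lemma run_lines (R : realType) (P : set 'rV[R]_2) :
  lattice_polygon P -> vertex_list P vs ->
  runs L lines_prog
    (find_best_work + (cwork emit_init + N.+1 * (ework cand_guard + cwork emit_body) +
       cwork (Write (Const 0) (Op Mul (Const 4) (reg rCnt))))) (input vs)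
    (fun m => exists2 out, holds_output m out & outputs_diameter_lines P out).
Proof.
move=> hP hvs; apply: runs_seq run_find_best _ => m bm.
move=> [v [a [b [b1 [b2 [best [[hv ha hb D0] q1 q2 [k0 kmax [j hj ej] kall kinj] [hs eb]]]]]]]].
apply: (@runs_seq _ _ _ _ _ _ (emit_inv vs b1 b2 best N)).
  apply: runs_seq; first exact: (run_emit_init n_gt0 c_gt0 big_L bm hs eb).
  by move=> m1 bm1; apply: (run_emit n_gt0 c_gt0 big_L vs_c hv ha hb D0 q1 q2 bm1).
move=> m1 bm1 [hs1 _ _ _ [hits [last [[[hu hsz _] hsound hcomp _] _ ecnt eout]]]].
apply: (wp_runs L0 bm1); cbn [wp].
rewrite [eval m1 (Op _ _ _)](_ : _ = Posz (4 * size hits)); last by rewrite /= ecnt -PoszM.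
split; first by apply: (fits_n3 n_gt0 c_gt0 big_L); rewrite /N in hsz; lia.
have esz : size (encode_lines (hit_lines b1 b2 hits)) = (4 * size hits)%N.
  by rewrite size_encode_lines size_map.
exists (encode_lines (hit_lines b1 b2 hits)).
  by split; rewrite ?esz // => i hi; apply: eout.
exists (hit_lines b1 b2 hits) => //.
apply: (diameter_lines_of_hits hP hvs k0 kmax kall kinj _ hu).
- have [h1 h2 h3] := triple_mem n_gt0 (cell_t_lt n_gt0 j).
  by exists (cell_u vs b1 b2 j), (triple_v vs (cell_t vs j)), (triple_a vs (cell_t vs j)), (triple_b vs (cell_t vs j)).
- move=> k w /hsound[i hi [ei [-> ->]]].
  have [h1 h2 h3] := triple_mem n_gt0 (cell_t_lt n_gt0 i).
  split=> //; first exact: cell_c_range hi.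
  by exists (triple_a vs (cell_t vs i)), (triple_b vs (cell_t vs i)).
- move=> k p q r hk hp hq hr e.
  have [i hi [ec e1 e2 e3]] := cell_exists n_gt0 c_gt0 big_L hv ha hb D0 q1 q2 hk hp hq hr.
  by rewrite -ec; apply: hcomp => //; rewrite /cell_reach /cell_u ec e1 e2 e3.
Qed.

End FindBest.

(** With [z = n + l] one has [L <= 17 * z], whence [289 = 17 ^ 2], and every number of rounds is at
    most a constant times [z ^ 3]. *)
Lemma polynomial_bound (n l L w0 w1 w2 w3 w4 : nat) : (0 < n)%N ->
  L = (14 + 3 * (n + l))%N ->
  ((w0 + w1 * (2 * n).+1 + w2 * (n ^ 3).+1 + w3 * L.+1 + w4 * (480 * n ^ 3).+1) * L ^ 2
   <= 289 * (w0 + w1 * 3 + w2 * 2 + w3 * 18 + w4 * 481) * (n + l) ^ 5)%N.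
Proof.
move=> n0 eL; set z := (n + l)%N; have z0 : (0 < z)%N by rewrite addn_gt0 n0.
have hn : (n <= z)%N by rewrite leq_addr.
have z3 : (0 < z ^ 3)%N by rewrite expn_gt0 z0.
have n3 : (n ^ 3 <= z ^ 3)%N by rewrite leq_exp2r.
have z13 : (z <= z ^ 3)%N by rewrite -{1}[z]expn1 leq_pexp2l.
have hL : (L <= 17 * z)%N by rewrite eL -/z; lia.
have -> : (289 * (w0 + w1 * 3 + w2 * 2 + w3 * 18 + w4 * 481) * z ^ 5 =
   ((w0 + w1 * 3 + w2 * 2 + w3 * 18 + w4 * 481) * z ^ 3) * (17 * z) ^ 2)%N.
  have e5 : (z ^ 5 = z ^ 3 * z ^ 2)%N by rewrite -expnD.
  rewrite expnMn e5 (_ : 17 ^ 2 = 289)%N //.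
  move: (w0 + w1 * 3 + w2 * 2 + w3 * 18 + w4 * 481)%N => w.
  by move: (z ^ 3)%N (z ^ 2)%N => x y; clear; lia.
apply: leq_mul; last by rewrite leq_exp2r.
rewrite !mulnDl -!mulnA.
have b (w x y : nat) : (x <= y)%N -> (w * x <= w * y)%N by move=> h; rewrite leq_mul2l h orbT.
move: (z ^ 3)%N (n ^ 3)%N z3 n3 z13 => x y z3 n3 z13.
have h0 : (w0 <= w0 * x)%N by rewrite leq_pmulr.
have h1 : ((2 * n).+1 <= 3 * x)%N by lia.
have h2 : (y.+1 <= 2 * x)%N by lia.
have h3 : (L.+1 <= 18 * x)%N by lia.
have h4 : ((480 * y).+1 <= 481 * x)%N by lia.
exact: leq_add (leq_add (leq_add (leq_add h0 (b _ _ _ h1)) (b _ _ _ h2)) (b _ _ _ h3)) (b _ _ _ h4).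
Qed.

Lemma polygon_problem_of_runs (R : realType) (post : set 'rV[R]_2 -> seq int -> Prop)
    prog w0 w1 w2 w3 w4 :
  (forall (vs : seq pt) (c L : nat), (0 < size vs)%N -> (0 < c)%N ->
    (2000 * size vs ^ 3 * c ^ 3 < 2 ^ L)%N ->
    (forall v, v \in vs -> (`|v.1| <= c)%N /\ (`|v.2| <= c)%N) ->
    (exists v a b, [/\ v \in vs, a \in vs, b \in vs & area v a b != 0]) ->
    forall P, lattice_polygon P -> vertex_list P vs ->
    runs L prog (w0 + w1 * (2 * size vs).+1 + w2 * (size vs ^ 3).+1 + w3 * L.+1
                 + w4 * (480 * size vs ^ 3).+1) (input vs)
      (fun m => exists2 out, holds_output m out & post P out)) ->
  polygon_problem_in_polytime post.
Proof.
move=> H; exists prog, (289 * (w0 + w1 * 3 + w2 * 2 + w3 * 18 + w4 * 481))%N, 5%N.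
move=> P vs hP hvs; have span := polygon_triangle hP hvs.
have [v [a [b [hv ha hb D0]]]] := span.
have n0 : (0 < size vs)%N by case: (vs) hv.
set c := max_coord vs; set l := trunc_log 2 c.
have vs_c w : w \in vs -> (`|w.1| <= c)%N /\ (`|w.2| <= c)%N.
  move=> hw; have : (maxn `|w.1| `|w.2| <= c)%N.
    exact: (@leq_bigmax_seq _ _ xpredT (fun z : pt => maxn `|z.1| `|z.2|) w hw isT).
  by rewrite geq_max => /andP[].
(* If all coordinates vanished, the nondegenerate triangle [v a b] could not exist. *)
have c0 : (0 < c)%N.
  rewrite lt0n; apply: contra_neq D0 => z.
  have zero w : w \in vs -> w = 0.
    by move=> /vs_c; rewrite z !leqn0 !absz_eq0; case: w => x y /= [/eqP-> /eqP->].
  by rewrite (zero v) // (zero a) // (zero b) // /area subrr /det2 mulr0 mul0r subrr.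
(* The estimates [2000 < 2 ^ 11], [n <= 2 ^ n] and [c < 2 ^ (l + 1)] add up to the exponent
   [11 + 3 * n + 3 * (l + 1)]. The crude bound on [n] is affordable since the time may be polynomial
   in [n] itself. *)
pose L := (14 + 3 * (size vs + l))%N.
have big_L : (2000 * size vs ^ 3 * c ^ 3 < 2 ^ L)%N.
  have e : (2 ^ L = 2 ^ 11 * (2 ^ size vs) ^ 3 * (2 ^ l.+1) ^ 3)%N.
    by rewrite -!expnM -!expnD; congr (_ ^ _)%N; rewrite /L; lia.
  rewrite e; have h1 : (size vs <= 2 ^ size vs)%N by rewrite ltnW // ltn_expl.
  have h2 : (c < 2 ^ l.+1)%N by apply: trunc_log_ltn.
  apply: (@leq_ltn_trans (2 ^ 11 * (2 ^ size vs) ^ 3 * c ^ 3)).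
    by rewrite leq_mul2r leq_mul ?leq_exp2r ?orbT.
  by rewrite ltn_pmul2l ?ltn_exp2r // muln_gt0 !expn_gt0.
have [t [m [x ht _ [out ho hpost]]]] := H vs c L n0 c0 big_L vs_c span P hP hvs.
by exists t, m, out; split=> //; apply: leq_trans ht (polynomial_bound _ _ _ _ _ n0 erefl).
Qed.

Theorem theorem2p4 (R : realType) :
  polygon_problem_in_polytime (@outputs_diameter_lines R) /\
  polygon_problem_in_polytime (@outputs_lattice_diameter R).
Proof.
split.
(* The weights are grouped by how often the work is done: once, per coordinate, per triple, per bit
   and per cell. Both passes over the cells share the last weight. *)
- apply: (@polygon_problem_of_runs _ _ lines_prog
   (cwork prologue + cwork area_init + cwork gauss_init + cwork best_init + cwork emit_init
      + cwork (Write (Const 0) (Op Mul (Const 4) (reg rCnt))))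
   (ework copy_guard + cwork copy_body) (ework area_guard + cwork area_body)
   (ework gauss_guard + cwork gauss_body)
   (ework cand_guard + cwork best_body + (ework cand_guard + cwork emit_body))).
  move=> vs c L n0 c0 big_L vs_c span P hP hvs.
  apply: runs_leq (run_lines n0 c0 big_L vs_c span hP hvs); rewrite /find_best_work.
  generalize (cwork prologue) (cwork area_init) (cwork gauss_init) (cwork best_init)
    (cwork emit_init) (cwork (Write (Const 0) (Op Mul (Const 4) (reg rCnt))))
    (ework copy_guard + cwork copy_body)%N (ework area_guard + cwork area_body)%N
    (ework gauss_guard + cwork gauss_body)%N (ework cand_guard + cwork best_body)%N
    (ework cand_guard + cwork emit_body)%N (size vs ^ 3)%N => *; lia.
- apply: (@polygon_problem_of_runs _ _ diameter_prog
   (cwork prologue + cwork area_init + cwork gauss_init + cwork best_init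
      + cwork (Write (Const 1) (reg rBest)) + cwork (Write (Const 0) (Const 1)))
   (ework copy_guard + cwork copy_body) (ework area_guard + cwork area_body)
   (ework gauss_guard + cwork gauss_body)
   (ework cand_guard + cwork best_body)).
  move=> vs c L n0 c0 big_L vs_c span P hP hvs.
  apply: runs_leq (run_diameter n0 c0 big_L vs_c span hP hvs); rewrite /find_best_work.
  generalize (cwork prologue) (cwork area_init) (cwork gauss_init) (cwork best_init)
    (cwork (Write (Const 1) (reg rBest))) (cwork (Write (Const 0) (Const 1)))
    (ework copy_guard + cwork copy_body)%N (ework area_guard + cwork area_body)%N
    (ework gauss_guard + cwork gauss_body)%N (ework cand_guard + cwork best_body)%N
    (size vs ^ 3)%N => *; lia.
Qed.
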